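(* Let $a>0$ and let $F=\{f_1<\cdots<f_k\}$ ($k\ge1$) be an admissible finite set of positive integers; let $G=I(F)=\{g_1<\cdots<g_m\}$. Then for every integer $n\ge v_F$: (i) $c_n^{a;F}(x)=\beta_n\det M_n(x)$, where $M_n(x)$ is the $(m+1)\times(m+1)$ matrix whose first row is $\Big(\frac{x(x-1)\cdots(x-j+1)}{a^j}\,c^a_{n-v_F}(x-j)\Big)_{j=0}^m$ and whose $(l+1)$-th row is $\big(c_{g_l}^{-a}(-x-1+j)\big)_{j=0}^m$, $l=1,\dots,m$, and $$\beta_n=(-1)^{m+k+u_F}\,\frac{a^m(n-v_F)!\,V_F\prod_{g\in G}g!\,\prod_{l=1}^k(f_l-n+u_F)}{(n-u_F)!\,V_G\prod_{f\in F}f!}.$$ (ii) $H_n^F(x)=\gamma_n\det N_n(x)$, where $N_n(x)$ is the $(m+1)\times(m+1)$ matrix whose first row is $\big((-i)^jH_{n-v_F+j}(x)\big)_{j=0}^m$ and whose $(l+1)$-th row is $\big(H_{g_l}^{(j)}(-ix)\big)_{j=0}^m$, $l=1,\dots,m$, with $i=\sqrt{-1}$, and $$\gamma_n=i^{u_G}\,2^{\binom{k+1}2-\binom m2}\,\frac{V_F}{V_G}\prod_{f\in F}(f-n+u_F).$$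
   Context: Charlier polynomials ($a\ne0$): $c_n^a(x)=\frac1{n!}\sum_{j=0}^n(-a)^{n-j}\binom nj\binom xj j!$. Hermite polynomials: $H_n(x)=n!\sum_{j=0}^{[n/2]}\frac{(-1)^j(2x)^{n-2j}}{j!(n-2j)!}$. For a finite set of positive integers $F=\{f_1<\cdots<f_k\}$: $u_F=\sum_{f\in F}f-\binom{k+1}{2}$; $v_F=\sum_{f\in F}f+f_k-\frac{(k-1)(k+2)}2=u_F+f_k+1$; $\sigma_F=\{u_F,u_F+1,\dots\}\setminus\{u_F+f: f\in F\}$ (which contains all $n\ge v_F$); $V_F=\prod_{1\le i<j\le k}(f_j-f_i)$; $I(F)=\{1,2,\dots,f_k\}\setminus\{f_k-f: f\in F\}$. The quantities $u_G,V_G$ are defined in the same way from $G$. For $n\in\sigma_F$, $c_n^{a;F}(x)$ is the $(k+1)\times(k+1)$ determinant whose first row is $(c^a_{n-u_F}(x+j))_{j=0}^{k}$ and whose $(l+1)$-th row is $(c^a_{f_l}(x+j))_{j=0}^k$, $l=1,\dots,k$; and $H_n^F(x)$ is the $(k+1)\times(k+1)$ determinant whose first row is $(H_{n-u_F}^{(j)}(x))_{j=0}^k$ and whose $(l+1)$-th row is $(H_{f_l}^{(j)}(x))_{j=0}^k$, $l=1,\dots,k$. In (ii), $H_{g}^{(j)}(-ix)$ denotes the $j$-th derivative of $H_g$ evaluated at $-ix$. Admissible: write $F=\bigcup_{i=1}^KY_i$ as a disjoint union where the elements of each $Y_i$ are consecutive integers and $1+\max Y_i<\min Y_{i+1}$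 for $i=1,\dots,K-1$. $F$ is admissible if every $Y_i$ has an even number of elements. *)

(* Defs.v *)
From HB Require Import structures.
From mathcomp Require Import all_boot all_order all_algebra.

Set Implicit Arguments.
Unset Strict Implicit.
Unset Printing Implicit Defensive.

Import Order.TTheory GRing.Theory Num.Theory.
Local Open Scope ring_scope.

(* A finite set of positive integers {f_1 < ... < f_k} is represented by its
   strictly increasing enumeration [:: f_1; ...; f_k]. *)
Definition is_pos_set (F : seq nat) : bool := sorted ltn F && all (leq 1) F.

(* f_k, when F is nonempty. *)
Definition maxF (F : seq nat) : nat := last 0%N F.

(* The truncated subtraction is exact here: k distinct positive integers sum
   to at least 1 + ... + k. *)
Definition uF (F : seq nat) : nat := (sumn F - 'C((size F).+1, 2))%N.

(* Equals sum F + f_k - (k - 1)(k + 2) / 2. *)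
Definition vF (F : seq nat) : nat := (uF F + maxF F + 1)%N.

(* Truncated subtraction is exact here since F is increasing. *)
Definition VF (F : seq nat) : nat :=
  (\prod_(j < size F) \prod_(i < j) (nth 0 F j - nth 0 F i))%N.

Definition IF (F : seq nat) : seq nat :=
  [seq j <- iota 1 (maxF F) | j \notin [seq (maxF F - f)%N | f <- F]].

(* a nonempty run of consecutive integers, in increasing order *)
Definition consecutive (Y : seq nat) : bool :=
  (0 < size Y)%N && (Y == iota (head 0%N Y) (size Y)).

(* F is the union of the runs Y_1, ..., Y_K, taken in increasing order, with
   1 + max Y_i < min Y_{i+1}. *)
Definition is_run_decomposition (Ys : seq (seq nat)) (F : seq nat) : Prop :=
  [/\ flatten Ys = F, all consecutive Ys
    & sorted (fun Y Z => (1 + last 0 Y < head 0 Z)%N) Ys].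

Definition admissible (F : seq nat) : Prop :=
  exists2 Ys, is_run_decomposition Ys F & all (fun Y => ~~ odd (size Y)) Ys.

Section Polynomials.
Variable K : numFieldType.
Implicit Types (a x : K) (F : seq nat) (n j : nat).

Definition falling x j : K := \prod_(l < j) (x - l%:R).

Definition gbinom x j : K := falling x j / j`!%:R.

Definition charlier a n x : K :=
  n`!%:R^-1 *
  \sum_(j < n.+1) (- a) ^+ (n - j) * 'C(n, j)%:R * gbinom x j * j`!%:R.

Definition hermite n : {poly K} :=
  n`!%:R *: \sum_(j < n./2.+1)
    ((-1) ^+ j / (j`! * (n - j.*2)`!)%:R) *: (2%:R *: 'X) ^+ (n - j.*2).

(* Row 0 of the matrices below has degree n - u_F and row l has degree f_l. *)
Definition row_deg F n (r : nat) : nat := nth 0%N ((n - uF F)%N :: F) r.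

Definition charlierF a F n x : K :=
  \det (\matrix_(r < (size F).+1, j < (size F).+1)
          charlier a (row_deg F n r) (x + j%:R)).

Definition hermiteF F n x : K :=
  \det (\matrix_(r < (size F).+1, j < (size F).+1)
          ((hermite (row_deg F n r))^`(j)).[x]).

Definition Mmx a F n x : 'M[K]_((size (IF F)).+1) :=
  \matrix_(r, j)
    (if (r : nat) is l.+1
     then charlier (- a) (nth 0%N (IF F) l) (- x - 1 + j%:R)
     else falling x j / a ^+ j * charlier a (n - vF F) (x - j%:R)).

Definition beta a F n : K :=
  let G := IF F in
  let k := size F in
  let m := size G in
  (-1) ^+ (m + k + uF F) *
  ((a ^+ m * (n - vF F)`!%:R * (VF F)%:R * (\prod_(g <- G) g`!%:R) *
    (\prod_(f <- F) (f%:R - n%:R + (uF F)%:R))) /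
   ((n - uF F)`!%:R * (VF G)%:R * (\prod_(f <- F) f`!%:R))).

End Polynomials.

Section ComplexPolynomials.
Variable C : numClosedFieldType.
Implicit Types (x : C) (F : seq nat) (n : nat).

Definition Nmx F n x : 'M[C]_((size (IF F)).+1) :=
  \matrix_(r, j)
    (if (r : nat) is l.+1
     then ((hermite C (nth 0%N (IF F) l))^`(j)).[- 'i * x]
     else (- 'i) ^+ j * (hermite C (n - vF F + j)).[x]).

(* The exponent of 2 may be negative, hence the integer power. *)
Definition gamma F n : C :=
  let G := IF F in
  let k := size F in
  let m := size G in
  'i ^+ (uF G) * 2%:R ^ ('C(k.+1, 2)%:Z - 'C(m, 2)%:Z) *
  ((VF F)%:R / (VF G)%:R) * \prod_(f <- F) (f%:R - n%:R + (uF F)%:R).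

End ComplexPolynomials.

(* Main.v *)
Require Import Defs.
From mathcomp Require Import all_boot all_order all_algebra.
From mathcomp Require Import perm zify ring.
From mathcomp Require Import reals complex.
Import Order.TTheory GRing.Theory Num.Theory.
Set Implicit Arguments.
Unset Strict Implicit.
Unset Printing Implicit Defensive.
Local Open Scope ring_scope.

(* Let H(t) be the generating function of the polynomials at a fixed x:
   (1 + t)^x exp (- a t) for Charlier, exp (2 x t - t^2) for Hermite. Put
   d = f_k, N = n - u_F and M = N - d - 1. Expanding the left-hand determinant
   along its first row gives (up to N! for Hermite) the coefficient of t^N in
   A(t) H(t), where the polynomial A does not depend on n and A H has vanishing
   coefficients at all f in F. Hence, as {0,...,d} is the disjoint union of F
   and {d - g : g in G}, the operator t^(-d-1) prod_g (t d/dt - d + g) sends A H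
   to a power series B H with no new pole, and the coefficient of t^M in B H is
   prod_g (M + 1 + g) times the left-hand side. Expand B H in the family whose
   coefficients of t^M are the entries of the first row of the right-hand
   matrix. Each t^g B H is the derivative of a decaying function, so its
   integral vanishes, and these integrals are, up to a factor depending on g
   only, the products of the other rows with the vector of coordinates of B.
   Cramer's rule then gives the identity up to the ratio of the minors
   attached to F and to G in the two determinants; these are complementary
   minors of the unitriangular Toeplitz matrices of H and 1/H, so Jacobi's
   theorem relates them. The minor of F, a nonzero polynomial in x, cancels.
   In the Charlier case it suffices to take x a large natural number. *)

(** * Complementary sets and complementary minors *)

Lemma bin2D p q : 'C(p + q, 2) = ('C(p, 2) + 'C(q, 2) + p * q)%N.
Proof.
elim: q => [|q IHq]; first by rewrite !addn0 muln0 addn0.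
by rewrite addnS !binS !bin1 IHq mulnS; lia.
Qed.

Lemma mul_pred_bin2 q : (q * q.-1)%N = ('C(q, 2)).*2.
Proof.
elim: q => // q IHq; rewrite binS bin1 doubleD -IHq /=.
by case: q {IHq} => //= q; lia.
Qed.

Lemma sumn_subl d (s : seq nat) : {in s, forall g, g <= d}%N ->
  (sumn [seq d - g | g <- s] + sumn s = size s * d)%N.
Proof.
elim: s => //= g s IHs sd.
have gd : (g <= d)%N by apply: sd; rewrite mem_head.
have := IHs (fun g' g's => sd g' (mem_behead (s := g :: s) g's)).
rewrite mulSn; lia.
Qed.

Lemma sumn_path_ge b (s : seq nat) : path ltn b s ->
  (b * size s + 'C((size s).+1, 2) <= sumn s)%N.
Proof.
elim: s b => [|f s IHs] b /=; first by rewrite muln0.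
move=> /andP[bf /IHs]; rewrite (binS (size s).+1) bin1.
move: (size s) (sumn s) => n t; move: ('C(_, _)) => c h; have := leq_mul bf (leqnn n); nia.
Qed.

(** Ensures that the truncated subtraction in [uF] is exact, for F as well as for G. *)
Lemma sumn_pos_set (s : seq nat) : sorted ltn s -> all (leq 1) s ->
  ('C((size s).+1, 2) <= sumn s)%N.
Proof.
case: s => // f s /= srt /andP[f0 _].
by have := @sumn_path_ge 0 (f :: s); rewrite mul0n /=; apply; rewrite f0.
Qed.

Section Complement.
Variable F : seq nat.
Hypotheses (hF : is_pos_set F) (hk : (0 < size F)%N).
Let d := maxF F.

Lemma pos_set_sorted : sorted ltn F. Proof. by case/andP: hF. Qed.

Lemma pos_set_uniq : uniq F.
Proof. exact: (sorted_uniq ltn_trans ltnn pos_set_sorted). Qed.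

Lemma maxF_mem : d \in F.
Proof. by rewrite /d /maxF; case: (F) hk => //= f s _; rewrite mem_last. Qed.

Lemma le_maxF f : f \in F -> (f <= d)%N.
Proof.
move=> /(nthP 0%N)[i ltiF <-]; rewrite /d /maxF -nth_last.
have F1 : ((size F).-1 < size F)%N by rewrite ltn_predL.
have i1 : (i <= (size F).-1)%N by rewrite -ltnS prednK.
have srt := sub_sorted (@ltnW) pos_set_sorted.
exact: (@sorted_leq_nth _ leq leq_trans leqnn 0%N F srt i (size F).-1 ltiF F1 i1).
Qed.

Lemma IF_sorted : sorted ltn (IF F).
Proof. by apply: sorted_filter (iota_ltn_sorted _ _); exact: ltn_trans. Qed.

Lemma IF_uniq : uniq (IF F).
Proof. by rewrite filter_uniq ?iota_uniq. Qed.

Lemma mem_IF g :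
  (g \in IF F) = [&& (0 < g)%N, (g <= d)%N & (d - g)%N \notin F].
Proof.
rewrite mem_filter mem_iota andbC -/d add1n ltnS -andbA.
case g0: (0 < g)%N => //=; case gd: (g <= d)%N => //=; congr (~~ _).
apply/mapP/idP => [[f fF ->]|gF]; first by rewrite subKn ?le_maxF.
by exists (d - g)%N; rewrite ?subKn.
Qed.

(** The map g -> d - g carries G onto the part of {0,...,d} outside F; the value g = 0, excluded
    from G, would give d, which lies in F. *)
Lemma perm_complement :
  perm_eq (F ++ [seq (d - g)%N | g <- IF F]) (iota 0 d.+1).
Proof.
apply: uniq_perm; rewrite ?iota_uniq //.
  rewrite cat_uniq pos_set_uniq /=; apply/andP; split.
    apply/hasPn => _ /mapP[g gG ->].
    by move: gG; rewrite mem_IF => /and3P[].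
  rewrite map_inj_in_uniq ?IF_uniq // => g g'.
  rewrite !mem_IF => /and3P[_ gd _] /and3P[_ gd' _] /(congr1 (subn d)).
  by rewrite !subKn.
move=> i; rewrite mem_cat mem_iota add0n leq0n ltnS /=.
apply/orP/idP => [[/le_maxF//|/mapP[g _ ->]]|id]; first exact: leq_subr.
case iF: (i \in F); [by left | right].
apply/mapP; exists (d - i)%N; last by rewrite subKn.
rewrite mem_IF subKn // iF leq_subr andbT subn_gt0.
by move: id; rewrite leq_eqVlt => /orP[/eqP id|//]; rewrite id maxF_mem in iF.
Qed.

Lemma size_complement : (size F + size (IF F))%N = d.+1.
Proof.
by have /perm_size := perm_complement; rewrite size_cat size_map size_iota.
Qed.

(** Equivalently u_F + k = u_G + m: F and G encode conjugate partitions, which have the same size.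
    It follows on summing [perm_complement]. *)
Lemma weight_complement :
  (sumn F + 'C(size (IF F), 2) = sumn (IF F) + 'C(size F, 2))%N.
Proof.
have sE : sumn (iota 0 d.+1) = 'C(d.+1, 2).
  by rewrite -bin2_sum sumnE /index_iota subn0.
have := perm_sumn perm_complement; rewrite sumn_cat sE.
have Gd : {in IF F, forall g, g <= d}%N.
  by move=> g; rewrite mem_IF => /and3P[].
have := sumn_subl Gd.
have := size_complement.
move: (d) (size F) (size (IF F)) (sumn _) (sumn _) (sumn _) => e k m a b c.
move=> h0; rewrite -h0 bin2D => h1 h2.
have hd : (m * e = m * k + 'C(m, 2).*2)%N.
  by rewrite -mul_pred_bin2; case: (m) h0 => [|p] h0 //=; rewrite -mulnDr; congr (_ * _)%N; lia.
lia.
Qed.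

End Complement.

Section Determinants.
Variable R : comNzRingType.

Lemma det_scale_rows n (c : 'I_n -> R) (A : 'M[R]_n) :
  \det (\matrix_(i, j) (c i * A i j)) = \prod_i c i * \det A.
Proof.
have -> : \matrix_(i, j) (c i * A i j) = diag_mx (\row_i c i) *m A.
  by rewrite mul_diag_mx; apply/matrixP=> i j; rewrite !mxE.
by rewrite det_mulmx det_diag; under eq_bigr do rewrite mxE.
Qed.

Lemma det_scale_cols n (c : 'I_n -> R) (A : 'M[R]_n) :
  \det (\matrix_(i, j) (A i j * c j)) = \prod_i c i * \det A.
Proof.
have -> : \matrix_(i, j) (A i j * c j) = A *m diag_mx (\row_i c i).
  by rewrite mul_mx_diag; apply/matrixP=> i j; rewrite !mxE.
by rewrite det_mulmx det_diag mulrC; under eq_bigr do rewrite mxE.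
Qed.

Lemma det_unitrig_cols n (A T : 'M[R]_n) :
    (forall i j : 'I_n, (j < i)%N -> T i j = 0) -> (forall i, T i i = 1) ->
  \det (A *m T) = \det A.
Proof.
move=> T0 T1; rewrite det_mulmx -(det_tr T) (_ : \det T^T = 1) ?mulr1 //.
rewrite det_trig; first by rewrite big1 // => i _; rewrite mxE T1.
by apply/is_trig_mxP => i j ij; rewrite mxE T0.
Qed.

(** Multiply A b by the adjugate: only its first entry survives. No division occurs, so A may be
    singular. *)
Lemma cramer_first_row n (A : 'M[R]_n.+1) (b : 'cV[R]_n.+1) (v : R) :
    (forall r, (A *m b) r 0 = (r == 0)%:R * v) ->
  forall j, \det A * b j 0 = cofactor A 0 j * v.
Proof.
move=> Ab j; have /matrixP/(_ j 0) : \adj A *m (A *m b) = \det A *: b.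
  by rewrite mulmxA mul_adj_mx mul_scalar_mx.
rewrite mxE (bigD1 0) //= big1 => [|r r0].
  by rewrite addr0 Ab mul1r !mxE => ->.
by rewrite Ab (negPf r0) mul0r mulr0.
Qed.

(* [h (i - j)], with the convention that [h] vanishes at negative indices *)
Definition toep (h : nat -> R) (i j : nat) : R :=
  if (j <= i)%N then h (i - j)%N else 0.

Definition conv (h e : nat -> R) (n : nat) : R :=
  \sum_(i < n.+1) h (n - i)%N * e i.

Definition conv_inverse (h e : nat -> R) : Prop :=
  forall n, conv h e n = (n == 0)%:R.

(** Truncating the sum at p loses nothing, since [toep h i l] vanishes for l > i. *)
Lemma toep_mul h e i j p : (i < p)%N ->
  \sum_(l < p) toep h i l * toep e l j =
  if (j <= i)%N then conv h e (i - j) else 0.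
Proof.
move=> ip; have [ji|ij] := leqP j i; last first.
  rewrite big1 // => l _; rewrite /toep.
  have [li|] := leqP l i; last by rewrite mul0r.
  by rewrite leqNgt (leq_ltn_trans li ij) mulr0.
rewrite -(big_mkord xpredT (fun l => toep h i l * toep e l j)).
rewrite (big_cat_nat _ (n := j)) //=; last exact: leq_trans ji (ltnW ip).
rewrite big_nat big1 ?add0r => [|l /andP[_ lj]]; last first.
  by rewrite /toep (leqNgt j) lj mulr0.
rewrite (big_cat_nat _ (n := i.+1)) //=; last exact: leq_trans ji _.
rewrite [X in _ + X]big_nat [X in _ + X]big1 ?addr0 => [|l /andP[il _]]; last first.
  by rewrite /toep leqNgt il mul0r.
rewrite -{1}(add0n j) big_addn subSn // big_mkord /conv; apply: eq_bigr => l _.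
have lij := ltn_ord l; rewrite /toep leq_addl addnK subnDA subnAC.
by rewrite (_ : (l + j <= i)%N) //; lia.
Qed.

Section Complement.
Variables (F G : seq nat) (d : nat).
Hypothesis FG : perm_eq (F ++ [seq (d - g)%N | g <- G]) (iota 0 d.+1).
Hypothesis Gd : forall g, g \in G -> (g <= d)%N.
Let k := size F.
Let m := size G.
Let s := F ++ [seq (d - g)%N | g <- G].

Let size_s : size s = (k + m)%N.
Proof. by rewrite size_cat size_map. Qed.

Let kmE : (k + m)%N = d.+1.
Proof. by rewrite -size_s (perm_size FG) size_iota. Qed.

(* Jacobi's complementary minor theorem for mutually inverse unitriangular
   Toeplitz matrices; q is the sign of the permutation listing F and then its
   complement. *)
Lemma det_toep_complement_sign : exists q : R,
  forall h e, h 0%N = 1 -> conv_inverse h e ->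
    \det (\matrix_(l < k, j < k) toep h (nth 0%N F l) j)
    = q * \det (\matrix_(l < m, j < m) toep e (nth 0%N G l) j).
Proof.
pose Q : 'M[R]_(k + m) := \matrix_(l, i) (i == nth 0%N s l :> nat)%:R.
pose J : 'M[R]_m := \matrix_(i, j) (j == rev_ord i)%:R.
exists (\det Q * \det J) => h e h0 he.
have s_lt (l : 'I_(k + m)) : (nth 0%N s l < k + m)%N.
  have : nth 0%N s l \in s by rewrite mem_nth // size_s.
  by move: (nth _ _ _) => i; rewrite (perm_mem FG) mem_iota kmE.
pose U : 'M[R]_(k + m) := \matrix_(i, j) toep h i j.
pose V : 'M[R]_(k + m) := \matrix_(i, l) toep e i (nth 0%N s l).
have QUE l j : (Q *m U) l j = toep h (nth 0%N s l) j.
  rewrite !mxE (bigD1 (Ordinal (s_lt l))) //= !mxE eqxx mul1r big1 ?addr0 //.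
  by move=> i; rewrite -val_eqE /= !mxE => /negPf->; rewrite mul0r.
have detU : \det U = 1.
  rewrite det_trig; last by apply/is_trig_mxP => i j ij; rewrite mxE /toep leqNgt ij.
  by rewrite big1 // => i _; rewrite mxE /toep leqnn subnn.
have QUV : Q *m U *m V = 1%:M.
  apply/matrixP => l l'; rewrite mxE.
  under eq_bigr do rewrite QUE [V _ _]mxE.
  rewrite toep_mul // he mxE -val_eqE /=.
  have -> : (l == l' :> nat) = (nth 0%N s l == nth 0%N s l').
    by rewrite nth_uniq ?size_s // (perm_uniq FG) iota_uniq.
  move: (nth _ _ _) (nth _ _ _) => u v.
  by rewrite subn_eq0; case: ltngtP.
(* V is the inverse of Q U. Multiplying Q U by the identity whose last m columns are replaced by
   those of V makes both sides block triangular, and determinants relate the two complementary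
   blocks. *)
have : Q *m U *m row_mx (col_mx 1%:M 0) (rsubmx V)
       = block_mx (ulsubmx (Q *m U)) 0 (dlsubmx (Q *m U)) 1%:M.
  rewrite mul_mx_row -[Q *m U in LHS]submxK {1}/block_mx.
  rewrite -[in X in row_mx X _]/(block_mx _ _ _ _) mul_block_col.
  rewrite !mulmx1 !mulmx0 !addr0 submxK.
  have -> : Q *m U *m rsubmx V = rsubmx (Q *m U *m V).
    by rewrite -mulmx_rsub.
  rewrite QUV scalar_mx_block block_mxEh row_mxKr.
  by rewrite -block_mxEh.
move=> /(congr1 determinant).
rewrite det_lblock det1 mulr1 !det_mulmx detU mulr1.
have -> : row_mx (col_mx 1%:M 0) (rsubmx V) =
    block_mx 1%:M (ursubmx V) 0 (drsubmx V).
  by rewrite -{1}[V]submxK !block_mxEh row_mxKr.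
rewrite det_ublock det1 mul1r => E.
have <- : ulsubmx (Q *m U) = \matrix_(l < k, j < k) toep h (nth 0%N F l) j.
  apply/matrixP => l j; rewrite 2![LHS]mxE QUE [RHS]mxE /s nth_cat.
  by rewrite /= ltn_ord.
rewrite -E -mulrA; congr (_ * _).
(* Row k + i of V has e(g - (m - 1 - i)) in the column of d - g, because k + m = d + 1. Transposing
   and reversing the rows gives the minor of G. *)
rewrite -[X in _ = _ * X]det_tr -det_mulmx; congr (\det _).
apply/matrixP => i l; rewrite !mxE (bigD1 (rev_ord i)) //= !mxE eqxx mul1r.
rewrite big1 ?addr0 => [|j /negPf jE]; last by rewrite !mxE jE mul0r.
rewrite nth_cat ifN -?leqNgt ?leq_addr // addKn (nth_map 0%N) //.
have gd : (nth 0%N G l <= d)%N by apply: Gd; rewrite mem_nth.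
rewrite /toep; have := ltn_ord i; have := kmE; move: (nth _ _ _) gd => g gd e1 im.
move=> /=; case: leqP => h1; case: leqP => h2 //; first by congr (e _); lia.
  by exfalso; lia.
by exfalso; lia.
Qed.

End Complement.

End Determinants.

(** * Vandermonde determinants and the constant in Jacobi's theorem *)

Section Vandermonde.
Variable K : numFieldType.
Implicit Types (F G : seq nat) (x : K).

Definition falling_poly j : {poly K} := \prod_(l < j) ('X - l%:R%:P).

Lemma horner_falling_poly x j : (falling_poly j).[x] = falling x j.
Proof. by rewrite horner_prod; apply: eq_bigr => l _; rewrite hornerXsubC. Qed.

Lemma size_falling_poly j : size (falling_poly j) = j.+1.
Proof.
rewrite /falling_poly -(big_mkord xpredT (fun l => 'X - l%:R%:P)).
by rewrite size_prod_XsubC size_iota subn0.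
Qed.

Lemma falling_poly_monic j : falling_poly j \is monic.
Proof. exact: monic_prod_XsubC. Qed.

Lemma falling_nat n j : falling (n%:R : K) j = (n ^_ j)%:R.
Proof.
elim: j => [|j IHj]; first by rewrite /falling big_ord0 ffactn0.
rewrite /falling big_ord_recr /= -/(falling _ _) IHj ffactnSr natrM.
have [jn|nj] := leqP j n; first by rewrite natrB.
by rewrite ffact_small // !mul0r.
Qed.

(** Falling factorials are monic of degree j, so they differ from the powers by a unitriangular
    change of basis, and the determinant is that of Vandermonde. *)
Lemma det_falling F : sorted ltn F ->
  \det (\matrix_(l < size F, j < size F) falling ((nth 0%N F l)%:R : K) j)
  = (VF F)%:R.
Proof.
move=> srt; set k := size F.
pose a : 'rV[K]_k := \row_l (nth 0%N F l)%:R.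
pose T : 'M[K]_k := \matrix_(i, j) (falling_poly j)`_i.
have -> : \matrix_(l, j) falling ((nth 0%N F l)%:R : K) j = (Vandermonde k a)^T *m T.
  apply/matrixP => l j; rewrite !mxE -horner_falling_poly.
  rewrite (horner_coef_wide (n := k)) ?size_falling_poly //.
  by apply: eq_bigr => i _; rewrite !mxE mulrC.
rewrite det_unitrig_cols => [|i j ij|i]; first last.
- rewrite mxE; have /monicP := falling_poly_monic i.
  by rewrite lead_coefE size_falling_poly.
- by rewrite mxE nth_default // size_falling_poly.
rewrite det_tr det_Vandermonde /VF natr_prod (exchange_big_dep xpredT) //=.
apply: eq_bigr => j _; rewrite natr_prod.
rewrite (big_ord_widen_cond _ xpredT
  (fun i => (nth 0%N F j - nth 0%N F i)%:R : K) (ltnW (ltn_ord j))).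
apply: eq_bigr => i /= ij; rewrite !mxE natrB //.
have := sorted_ltn_nth ltn_trans 0%N srt.
by move=> /(_ i j); rewrite !inE !ltn_ord => /(_ isT isT ij)/ltnW.
Qed.

(** Since 1 / (f - j)! is the falling factorial of f of length j divided by f!, this is
    [det_falling] with rescaled rows. *)
Lemma det_toep_exp F : sorted ltn F ->
  \det (\matrix_(l < size F, j < size F) toep (fun n => n`!%:R^-1 : K) (nth 0%N F l) j)
  = (VF F)%:R / \prod_(f <- F) f`!%:R.
Proof.
move=> srt; rewrite -det_falling // mulrC (big_nth 0%N) big_mkord -prodfV.
rewrite -det_scale_rows; congr (\det _); apply/matrixP => l j.
rewrite !mxE falling_nat /toep; case: leqP => [jl|lj]; last first.
  by rewrite ffact_small // mulr0.
move: (nth _ _ _) jl => f jl; rewrite -(ffact_fact jl) natrM invfM mulrAC.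
by rewrite mulVf ?mul1r // pnatr_eq0 -lt0n ffact_gt0.
Qed.

Lemma conv_inverse_exp :
  conv_inverse (fun n => n`!%:R^-1 : K) (fun n => (-1) ^+ n / n`!%:R).
Proof.
move=> n; rewrite /conv; apply: (mulfI (x := n`!%:R)).
  by rewrite pnatr_eq0 -lt0n fact_gt0.
transitivity ((1 + -1 : K) ^+ n); last first.
  by rewrite subrr expr0n; case: n => [|n]; rewrite ?mulr0 ?mulr1.
rewrite exprDn mulr_sumr; apply: eq_bigr => i _.
have iN : (i <= n)%N by rewrite -ltnS.
rewrite expr1n !mul1r -mulr_natr.
rewrite -(bin_fact iN) !natrM.
by field; rewrite !pnatr_eq0 -!lt0n !fact_gt0.
Qed.

(** The sign (-1)^(f - j) splits into a row sign and a column sign. *)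
Lemma det_toep_exp_inv F : sorted ltn F ->
  \det (\matrix_(l < size F, j < size F)
     toep (fun n => (-1) ^+ n / n`!%:R : K) (nth 0%N F l) j)
  = (-1) ^+ (sumn F + 'C(size F, 2)) * ((VF F)%:R / \prod_(f <- F) f`!%:R).
Proof.
move=> srt; rewrite -det_toep_exp // exprD -mulrA -bin2_sum.
rewrite big_mkord -prodrXr -det_scale_cols.
rewrite sumnE (big_nth 0%N) big_mkord -prodrXr -det_scale_rows.
congr (\det _); apply/matrixP => l j; rewrite !mxE /toep.
case: leqP => [jl|]; last by rewrite mul0r mulr0.
rewrite mulrCA [RHS]mulrC; congr (_ / _); rewrite -exprD.
by rewrite -[LHS]signr_odd -[RHS]signr_odd oddB // oddD.
Qed.

Lemma VF_neq0 F : sorted ltn F -> (VF F)%:R != 0 :> K.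
Proof.
move=> srt; rewrite pnatr_eq0 -lt0n /VF; apply/prodn_gt0 => j.
apply/prodn_gt0 => i; rewrite subn_gt0.
have := sorted_ltn_nth ltn_trans 0%N srt.
move=> /(_ i j); rewrite !inE (ltn_ord j) (ltn_trans (ltn_ord i)) //.
by apply.
Qed.

Lemma prod_fact_neq0 F : \prod_(f <- F) f`!%:R != 0 :> K.
Proof. by rewrite prodf_seq_neq0; apply/allP => f _; rewrite pnatr_eq0 -lt0n fact_gt0. Qed.

(* The sign and the factor V_F / V_G come from the case H(t) = exp t, where both
   minors are Vandermonde determinants. *)
Lemma det_toep_complement F : is_pos_set F -> (0 < size F)%N ->
  forall h e : nat -> K, h 0%N = 1 -> conv_inverse h e ->
  \det (\matrix_(l < size F, j < size F) toep h (nth 0%N F l) j)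
  = (-1) ^+ (sumn (IF F) + 'C(size (IF F), 2)) *
    ((VF F)%:R * (\prod_(g <- IF F) g`!%:R)) /
    ((VF (IF F))%:R * (\prod_(f <- F) f`!%:R)) *
    \det (\matrix_(l < size (IF F), j < size (IF F)) toep e (nth 0%N (IF F) l) j).
Proof.
move=> hF hk h e h0 he; set G := IF F.
have Gd g : g \in G -> (g <= maxF F)%N by rewrite mem_IF // => /and3P[].
have srtF := pos_set_sorted hF; have srtG := IF_sorted F.
have [q qE] := det_toep_complement_sign K (perm_complement hF hk) Gd.
rewrite (qE h e h0 he); congr (_ * _).
have := qE _ _ _ conv_inverse_exp; rewrite fact0 invr1 => /(_ erefl).
rewrite det_toep_exp // det_toep_exp_inv // -/G.
have VG := VF_neq0 srtG; have VFn := VF_neq0 srtF.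
have PF := prod_fact_neq0 F; have PG := prod_fact_neq0 G.
have := signr_eq0 K (sumn G + 'C(size G, 2)).
have : (-1) ^+ (sumn G + 'C(size G, 2)) * (-1) ^+ (sumn G + 'C(size G, 2)) = 1 :> K.
  by rewrite -expr2 sqrr_sign.
move: (_ ^+ _) => sg sg2 /negbT sg0 E.
apply: (mulIf (x := sg * ((VF G)%:R / (\prod_(g <- G) g`!%:R)))).
  by rewrite !mulf_neq0 ?invr_neq0.
rewrite -E -[LHS]mul1r -[X in X * _]sg2; field.
by rewrite PG PF VG.
Qed.

End Vandermonde.

(** * Weighted Euler operators *)

Section Weighted.
Variable K : numFieldType.
Variables (w : {poly K}) (eta : nat -> K).
Implicit Types (q : {poly K}) (cs : seq nat).

(* The coefficient of t^n in q(t) H(t), where H(t) = sum_n eta(n) t^n. *)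
Definition wcoef q n : K := \sum_(i < n.+1) q`_i * eta (n - i)%N.

(* The logarithmic derivative of H is w, so (q H)' = (wderiv q) H. *)
Definition wderiv q : {poly K} := q^`() + w * q.

(* With theta = t d/dt, (theta - c)(q H) = (weuler c q) H. *)
Definition weuler (c : nat) q : {poly K} := 'X * wderiv q - c%:R *: q.

Hypothesis eta0 : eta 0%N = 1.
Hypothesis eta_deriv : forall n, wcoef w n = n.+1%:R * eta n.+1.

Lemma wcoefD q1 q2 n : wcoef (q1 + q2) n = wcoef q1 n + wcoef q2 n.
Proof. by rewrite -big_split; apply: eq_bigr => i _; rewrite coefD mulrDl. Qed.

Lemma wcoefZ c q n : wcoef (c *: q) n = c * wcoef q n.
Proof. by rewrite mulr_sumr; apply: eq_bigr => i _; rewrite coefZ mulrA. Qed.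

Lemma wcoef0 n : wcoef 0 n = 0.
Proof. by rewrite /wcoef big1 // => i _; rewrite coef0 mul0r. Qed.

Lemma wcoef_sum (I : finType) (q : I -> {poly K}) n :
  wcoef (\sum_i q i) n = \sum_i wcoef (q i) n.
Proof.
by elim/big_rec2: _ => [|i x y _ <-]; rewrite ?wcoef0 ?wcoefD.
Qed.

Lemma wcoefC c n : wcoef c%:P n = c * eta n.
Proof.
rewrite /wcoef big_ord_recl coefC eqxx subn0 big1 ?addr0 // => i _.
by rewrite coefC mul0r.
Qed.

Lemma wcoefMX q n : wcoef (q * 'X) n = if n is p.+1 then wcoef q p else 0.
Proof.
case: n => [|n]; rewrite /wcoef big_ord_recl coefMX mul0r.
  by rewrite big_ord0 addr0.
by rewrite add0r; apply: eq_bigr => i _; rewrite coefMX.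
Qed.

Lemma wcoefMXn q c n :
  wcoef (q * 'X^c) n = if (c <= n)%N then wcoef q (n - c) else 0.
Proof.
elim: c n => [|c IHc] n; first by rewrite expr0 mulr1 subn0.
by rewrite exprSr mulrA wcoefMX; case: n => // n; rewrite IHc.
Qed.

Lemma wcoef_wderiv q n : wcoef (wderiv q) n = n.+1%:R * wcoef q n.+1.
Proof.
elim/poly_ind: q n => [|q c IHq] n.
  by rewrite /wderiv deriv0 mulr0 addr0 !wcoef0 mulr0.
have -> : wderiv (q * 'X + c%:P) = wderiv q * 'X + q + c *: w.
  by rewrite /wderiv derivD derivM derivX derivC -mul_polyC; ring.
rewrite !wcoefD wcoefZ eta_deriv !wcoefMX wcoefC.
by case: n => [|n]; rewrite ?IHq -?natr1; ring.
Qed.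

Lemma wcoef_weuler c q n : wcoef (weuler c q) n = (n%:R - c%:R) * wcoef q n.
Proof.
rewrite /weuler -scaleNr wcoefD wcoefZ mulrC wcoefMX mulrBl mulNr.
by case: n => [|n]; rewrite ?wcoef_wderiv ?mul0r.
Qed.

(** H has constant term 1, hence is invertible, so q vanishes at 0 to the same order as q H. *)
Lemma wcoef_eq0 q c : (forall n, (n < c)%N -> wcoef q n = 0) ->
  exists W, q = W * 'X^c.
Proof.
move=> q0; exists (drop_poly c q); rewrite -{1}(poly_take_drop c q).
suff -> : take_poly c q = 0 by rewrite add0r.
apply/polyP => n; rewrite coef_take_poly coef0; case: ltnP => //.
elim/ltn_ind: n => n IHn nc; have := q0 n nc.
rewrite /wcoef big_ord_recr /= subnn eta0 mulr1 big1 ?add0r // => i _.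
by rewrite IHn ?mul0r // (ltn_trans _ nc).
Qed.

Lemma wcoef_inj q1 q2 : (forall n, wcoef q1 n = wcoef q2 n) -> q1 = q2.
Proof.
move=> E; apply/eqP; rewrite -subr_eq0; apply/eqP/polyP => n; rewrite coef0.
have [] := @wcoef_eq0 (q1 - q2) n.+1 => [i _|W ->].
  by rewrite -scaleN1r wcoefD wcoefZ E mulN1r subrr.
by rewrite coefMXn ltnSn.
Qed.

Lemma wcoef_foldr cs q n :
  wcoef (foldr weuler q cs) n = \prod_(c <- cs) (n%:R - c%:R) * wcoef q n.
Proof.
elim: cs => [|c cs IHcs] /=; first by rewrite big_nil mul1r.
by rewrite wcoef_weuler IHcs big_cons mulrA.
Qed.

(** As theta - c kills t^c, only the derivative of q H remains. This is what produces exact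
    derivatives below. *)
Lemma weuler_mulXn c q : weuler c (q * 'X^c) = wderiv q * 'X^(c.+1).
Proof.
rewrite /weuler /wderiv derivM derivXn; case: c => [|c].
  by rewrite expr0 scale0r expr1; ring.
rewrite -scaler_nat /= -!mul_polyC !exprS; ring.
Qed.

Section Quotient.
Variables (F G : seq nat) (d : nat) (q : {poly K}).
Let cs := [seq (d - g)%N | g <- G].
Hypothesis FG : perm_eq (F ++ cs) (iota 0 d.+1).
Hypothesis Gd : forall g, g \in G -> (g <= d)%N.
Hypothesis q0 : forall f, f \in F -> wcoef q f = 0.

(* Multiplying the coefficient of t^n in q H by prod_c (n - c) and shifting by
   d + 1 loses nothing, since the coefficients of index at most d all vanish;
   moreover t^g B H is then an exact derivative for every g in G. *)
Lemma weuler_quotient : exists B,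
  [/\ B * 'X^(d.+1) = foldr weuler q cs,
      forall M, wcoef B M = \prod_(g <- G) (M.+1 + g)%:R * wcoef q (M + d.+1)
    & forall g, g \in G -> exists W,
        'X^g * B = wderiv W /\ W * 'X^(d - g) = foldr weuler q (rem (d - g)%N cs)].
Proof.
have [n nd|B BE] := @wcoef_eq0 (foldr weuler q cs) d.+1.
  rewrite wcoef_foldr; have : n \in F ++ cs.
    by rewrite (perm_mem FG) mem_iota.
  rewrite mem_cat => /orP[nF|ncs]; first by rewrite q0 ?mulr0.
  by rewrite (big_rem _ ncs) /= subrr !mul0r.
exists B; split=> // [M|g gG].
  have := wcoefMXn B d.+1 (M + d.+1); rewrite leq_addl addnK -BE wcoef_foldr => <-.
  congr (_ * _); rewrite big_map; apply: eq_big_seq => g gG.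
  by rewrite -natrB; [congr _%:R; have := Gd gG; lia | have := Gd gG; lia].
have csg : (d - g)%N \in cs by apply: map_f.
set q' := foldr weuler q (rem (d - g)%N cs).
(* The Euler factors act diagonally on coefficients, so the one attached to g can be moved
   outermost. *)
have Eq : foldr weuler q cs = weuler (d - g) q'.
  by apply: wcoef_inj => n; rewrite wcoef_weuler !wcoef_foldr (big_rem _ csg) /= mulrA.
(* Without that factor, every index n < d - g is still killed, either by F or by a remaining
   factor. *)
have [n nd|W WE] := @wcoef_eq0 q' (d - g)%N.
  rewrite wcoef_foldr; have : n \in F ++ cs.
    by rewrite (perm_mem FG) mem_iota ltnS (leq_trans (ltnW nd)) ?leq_subr.
  rewrite mem_cat => /orP[nF|ncs]; first by rewrite q0 ?mulr0.
  have ncs' : n \in rem (d - g)%N cs.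
    move: ncs; rewrite (perm_mem (perm_to_rem csg)) inE => /orP[/eqP nE|//].
    by rewrite nE ltnn in nd.
  by rewrite (big_rem _ ncs') /= subrr !mul0r.
exists W; split=> //.
apply: (mulIf (x := 'X^((d - g).+1))); first by rewrite -size_poly_eq0 size_polyXn.
rewrite -weuler_mulXn -WE -Eq BE mulrAC -exprD mulrC.
by congr (_ * 'X^_); have := Gd gG; lia.
Qed.

End Quotient.
End Weighted.

(** * Inverse series, graded bases, leading coefficients and polynomial functions *)

Section Generic.
Variable K : numFieldType.
Implicit Types (p q w : {poly K}).

Lemma wcoef_linear (eta : nat -> K) a b n :
  wcoef eta (a%:P + b *: 'X) n = a * eta n + (if n is p.+1 then b * eta p else 0).
Proof.
rewrite wcoefD wcoefC; congr (_ + _).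
rewrite -['X]mul1r wcoefZ wcoefMX; case: n => [|n]; rewrite ?mulr0 //.
by rewrite -[1]/(1%:P) wcoefC mul1r.
Qed.

(** If H' = w H and E' = - w E, then E H has zero derivative and constant term 1. In the proof E is
    truncated to a polynomial, which does not affect the coefficients in question. *)
Lemma conv_inverse_wderiv w (eta e : nat -> K) : eta 0%N = 1 -> e 0%N = 1 ->
    (forall n, wcoef eta w n = n.+1%:R * eta n.+1) ->
    (forall n, wcoef e w n = - (n.+1%:R * e n.+1)) ->
  conv_inverse eta e.
Proof.
move=> eta0 e0 Heta He n.
pose E := \poly_(i < n.+1) e i.
have Ec i : (i <= n)%N -> E`_i = e i by rewrite coef_poly ltnS => ->.
have -> : conv eta e n = wcoef eta E n.
  by apply: eq_bigr => i _; rewrite mulrC Ec // -ltnS.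
case: n @E Ec => [|n] E Ec.
  by rewrite /wcoef big_ord1 Ec // e0 eta0 mul1r.
apply: (mulfI (x := n.+1%:R)); first by rewrite pnatr_eq0.
rewrite -(wcoef_wderiv Heta) mulr0 /wcoef big1 // => i _.
have iN : (i <= n)%N by rewrite -ltnS.
rewrite /wderiv coefD coef_deriv coefM Ec //.
rewrite (_ : \sum_(j < i.+1) _ = wcoef e w i); last first.
  by apply: eq_bigr => j _; rewrite Ec // (leq_trans (leq_subr _ _)) // ltnW.
by rewrite He mulr_natl subrr mul0r.
Qed.

Lemma basis_decomposition (e : nat -> {poly K}) m q :
    (forall j, size (e j) = j.+1) -> (size q <= m.+1)%N ->
  exists b : nat -> K, q = \sum_(j < m.+1) b j *: e j
    /\ b m * lead_coef (e m) = q`_m.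
Proof.
move=> se; elim: m q => [|m IHm] q sq.
  exists (fun=> q`_0 / lead_coef (e 0%N)); rewrite big_ord1.
  have e0 : lead_coef (e 0%N) != 0 by rewrite lead_coef_eq0 -size_poly_eq0 se.
  split; last by rewrite divfK.
  have /size_poly1P[c _ ec] : size (e 0%N) == 1 by rewrite se.
  move: e0; rewrite ec lead_coefC => c0.
  by rewrite scale_polyC divfK //; exact: size1_polyC.
have em : lead_coef (e m.+1) != 0 by rewrite lead_coef_eq0 -size_poly_eq0 se.
pose c := q`_m.+1 / lead_coef (e m.+1).
have [|b [qE _]] := IHm (q - c *: e m.+1).
  apply/leq_sizeP => j; rewrite leq_eqVlt => /orP[/eqP <-|mj].
    have e1 : (e m.+1)`_m.+1 = lead_coef (e m.+1) by rewrite lead_coefE se.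
    by rewrite coefB coefZ e1 divfK ?subrr.
  rewrite coefB coefZ !nth_default ?mulr0 ?subrr ?se //.
  exact: leq_trans sq _.
exists (fun j => if j == m.+1 then c else b j); rewrite eqxx; split.
  rewrite big_ord_recr /= eqxx -[LHS](subrK (c *: e m.+1)) qE; congr (_ + _).
  by apply: eq_bigr => j _; rewrite ltn_eqF.
by rewrite divfK.
Qed.

Lemma coef_prod_top n (d : 'I_n -> nat) (Q : 'I_n -> {poly K}) :
    (forall l, size (Q l) <= (d l).+1)%N ->
  (\prod_l Q l)`_(\sum_l d l)%N = \prod_l (Q l)`_(d l).
Proof.
move=> sQ; suff [] : (size (\prod_l Q l)%R <= (\sum_l d l).+1)%N /\
  (\prod_l Q l)`_(\sum_l d l)%N = \prod_l (Q l)`_(d l) by [].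
apply: (big_rec3 (fun p s c => (size p <= s.+1)%N /\ p`_s = c)) => [|l p s c _ [sp <-]].
  by rewrite size_poly1 coef1.
have := size_polyMleq (Q l) p; have := sQ l => sQl sM.
split; first by lia.
have E : (Q l * p)`_(d l + s)%N = (Q l)`_(d l) * p`_s.
  rewrite coefM (bigD1 (inord (d l))) //= inordK ?addKn; last by lia.
  rewrite big1 ?addr0 // => i /eqP iN; have [il|il] := ltnP i (d l).
    rewrite [p`__]nth_default ?mulr0 //; apply: leq_trans sp _; lia.
  rewrite [(Q l)`__]nth_default ?mul0r //; apply: leq_trans sQl _.
  suff : i != d l :> nat by lia.
  by apply/eqP => ie; apply: iN; apply: val_inj; rewrite /= inordK ?ie //; lia.
exact: E.
Qed.

(** Each term of the Leibniz formula takes one entry per row, so the degree bounds add up and the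
    top coefficients multiply. *)
Lemma coef_det_top n (d : 'I_n -> nat) (Q : 'M[{poly K}]_n) :
    (forall l j, size (Q l j) <= (d l).+1)%N ->
  (\det Q)`_(\sum_l d l)%N = \det (\matrix_(l, j) (Q l j)`_(d l)).
Proof.
move=> sQ; rewrite /determinant coef_sum; apply: eq_bigr => s _.
have E : (\prod_i Q i (s i))`_(\sum_l d l)%N =
    \prod_i (\matrix_(l, j) (Q l j)`_(d l)) i (s i).
  by rewrite coef_prod_top //; apply: eq_bigr => l _; rewrite mxE.
by rewrite !mulr_sign; case: ifP; rewrite ?coefN E.
Qed.

Lemma det_toep_poly_neq0 (P : nat -> {poly K}) (c : K) (F : seq nat) :
    sorted ltn F -> c != 0 ->
    (forall n, size (P n) <= n.+1)%N -> (forall n, (P n)`_n = c ^+ n / n`!%:R) ->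
  \det (\matrix_(l < size F, j < size F) toep P (nth 0%N F l) j) != 0.
Proof.
move=> srt c0 sP Pn; apply/eqP => det0; move/eqP: c0; apply.
(* The factor ['X^j] bounds the degree of every entry in the row of f by f, whatever the column. *)
pose Q : 'M[{poly K}]_(size F) := \matrix_(l, j) (toep P (nth 0%N F l) j * 'X^j).
have : (\det Q)`_(\sum_(l < size F) nth 0%N F l)%N = 0.
  rewrite (_ : \det Q = 0) ?coef0 // -[RHS](mulr0 (\prod_(j < size F) 'X^j)) -det0.
  by rewrite -det_scale_cols; congr (\det _); apply/matrixP => l j; rewrite !mxE.
rewrite coef_det_top => [|l j]; last first.
  rewrite mxE /toep; case: ifP => [jl|_]; last by rewrite mul0r size_poly0.
  rewrite (leq_trans (size_polyMleq _ _)) // size_polyXn addnS /=.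
  by apply: leq_trans (leq_add (sP _) (leqnn j)) _; lia.
(* Scaling column j by c^j turns c^(f - j) into the row factor c^f and leaves the determinant of
   [det_toep_exp]. *)
move/(congr1 (fun y => \prod_(j < size F) c ^+ j * y)).
rewrite mulr0 -det_scale_cols.
rewrite (_ : \matrix_(_, _) _ = \matrix_(l, j) (c ^+ nth 0%N F l *
    (\matrix_(l < size F, j < size F) toep (fun n => n`!%:R^-1) (nth 0%N F l) j) l j)).
  rewrite det_scale_rows det_toep_exp // => /eqP.
  rewrite !mulf_eq0 invr_eq0 (negPf (VF_neq0 _ srt)) (negPf (prod_fact_neq0 _ F)) !orbF.
  by move=> /prodf_eq0[l _]; rewrite expf_eq0 => /andP[_ /eqP].
apply/matrixP => l j; rewrite !mxE /toep; case: ifP => jl.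
  by rewrite coefMXn ltnNge jl /= Pn mulrAC -exprD subnK.
by rewrite !(mul0r, mulr0, coef0).
Qed.

Definition polyfun (f : K -> K) : Prop := exists p, forall x, f x = p.[x].

Lemma polyfun_horner p : polyfun (fun x => p.[x]).
Proof. by exists p. Qed.

Lemma polyfun_cst c : polyfun (fun=> c).
Proof. by exists c%:P => x; rewrite hornerC. Qed.

Lemma polyfunM f g : polyfun f -> polyfun g -> polyfun (fun x => f x * g x).
Proof. by move=> [p fE] [q gE]; exists (p * q) => x; rewrite hornerM fE gE. Qed.

Lemma polyfun_comp_affine f a b : polyfun f -> polyfun (fun x => f (a * x + b)).
Proof.
move=> [p fE]; exists (p \Po (a *: 'X + b%:P)) => x.
by rewrite horner_comp fE !hornerE.
Qed.

Lemma polyfun_sum I (r : seq I) (P : pred I) (f : I -> K -> K) :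
  (forall i, polyfun (f i)) -> polyfun (fun x => \sum_(i <- r | P i) f i x).
Proof.
move=> pf; elim: r => [|i r [p IHr]].
  by exists 0 => x; rewrite big_nil horner0.
have [q fE] := pf i; exists (if P i then q + p else p) => x.
by rewrite big_cons; case: (P i); rewrite ?hornerD ?fE IHr.
Qed.

Lemma polyfun_prod I (r : seq I) (P : pred I) (f : I -> K -> K) :
  (forall i, polyfun (f i)) -> polyfun (fun x => \prod_(i <- r | P i) f i x).
Proof.
move=> pf; elim: r => [|i r [p IHr]].
  by exists 1 => x; rewrite big_nil hornerC.
have [q fE] := pf i; exists (if P i then q * p else p) => x.
by rewrite big_cons; case: (P i); rewrite ?hornerM ?fE IHr.
Qed.

Lemma polyfun_det n (A : K -> 'M[K]_n) :
  (forall i j, polyfun (fun x => A x i j)) -> polyfun (fun x => \det (A x)).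
Proof.
move=> pA; apply: polyfun_sum => s; apply: polyfunM; first exact: polyfun_cst.
exact: polyfun_prod.
Qed.

(** The polynomial (f - g) p has infinitely many roots, the natural numbers from s0 on, so it is
    zero; then the nonzero factor p cancels. *)
Lemma polyfun_eq f g d p s0 : polyfun f -> polyfun g ->
    (forall x, d x = p.[x]) -> p != 0 ->
    (forall s : nat, (s0 <= s)%N -> f s%:R * d s%:R = g s%:R * d s%:R) ->
  forall x, f x = g x.
Proof.
move=> [pf fE] [pg gE] dE p0 fg x.
suff : pf - pg == 0 by rewrite subr_eq0 fE gE => /eqP->.
have : (pf - pg) * p == 0; last by rewrite mulf_eq0 (negPf p0) orbF.
apply: contraT => q0.
pose q := (pf - pg) * p; pose rs : seq K := [seq (s0 + i)%:R | i <- iota 0 (size q)].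
have := max_poly_roots q0 (rs := rs); rewrite size_map size_iota ltnn; apply.
  apply/allP => _ /mapP[i _ ->]; apply/rootP; rewrite hornerM hornerD hornerN.
  by rewrite -fE -gE -dE mulrBl fg ?leq_addr // subrr.
rewrite map_inj_uniq ?iota_uniq // => i j /eqP.
by rewrite eqr_nat eqn_add2l => /eqP.
Qed.

End Generic.

(** * Hermite polynomials *)

Section HermitePoly.
Variable K : numFieldType.

Let natr_fact_neq0 n : n`!%:R != 0 :> K.
Proof. by rewrite pnatr_eq0 -lt0n fact_gt0. Qed.

Lemma coef_hermite n i :
  (hermite K n)`_i = n`!%:R *
    (if (i <= n)%N && ~~ odd (n - i)
     then (-1) ^+ (n - i)./2 * 2%:R ^+ i / ((n - i)./2`! * i`!)%:R else 0).
Proof.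
rewrite /hermite coefZ coef_sum; congr (_ * _).
have E (j : 'I_(n./2.+1)) : (((-1) ^+ j / (j`! * (n - j.*2)`!)%:R) *:
    (2%:R *: 'X : {poly K}) ^+ (n - j.*2))`_i =
    if i == (n - j.*2)%N then (-1) ^+ j * 2%:R ^+ i / (j`! * i`!)%:R else 0.
  rewrite coefZ exprZn coefZ coefXn.
  by case: eqP => [->|_]; rewrite ?mulr0 // mulr1 mulrAC.
under eq_bigr do rewrite E.
case: ifP => [/andP[iN ev]|nev]; last first.
  rewrite big1 // => j _; case: eqP => // ij; move: nev.
  have := ltn_ord j; have := odd_double_half n; have := leq_subr j.*2 n.
  rewrite -ij => h1 h2 h3; rewrite h1 /=.
  by rewrite (_ : (n - i = j.*2)%N) ?odd_double //; lia.
have jP : ((n - i)./2 < n./2.+1)%N by rewrite ltnS half_leq // leq_subr.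
have jE : ((n - i)./2.*2 = n - i)%N by have := odd_double_half (n - i); rewrite (negPf ev).
rewrite (bigD1 (Ordinal jP)) //= jE subKn // eqxx big1 ?addr0 // => j /eqP jn.
case: eqP => // ij; case: jn; apply: val_inj => /=.
by have := ltn_ord j; have := odd_double_half n; lia.
Qed.

Lemma size_hermite n : (size (hermite K n) <= n.+1)%N.
Proof.
by apply/leq_sizeP => i ni; rewrite coef_hermite leqNgt ni mulr0.
Qed.

Lemma deriv_hermite n : (hermite K n)^`() = (2 * n)%:R *: hermite K n.-1.
Proof.
apply/polyP => i; rewrite coef_deriv coefZ !coef_hermite -[LHS]mulr_natl.
case: n => [|n]; first by rewrite /= !mulr0 muln0 mul0r.
rewrite ltnS subSS /=; case: ifP => [|_]; last by rewrite !mulr0.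
move=> _; rewrite !factS exprS !natrM -natr1.
by field; rewrite natr1 !natr_fact_neq0 pnatr_eq0.
Qed.

Lemma derivn_hermite n j :
  (hermite K n)^`(j) = (2 ^ j * n ^_ j)%:R *: hermite K (n - j).
Proof.
elim: j => [|j IHj]; first by rewrite subn0 ffactn0 scale1r.
rewrite derivnS IHj derivZ deriv_hermite scalerA -natrM subnS; congr (_%:R *: _).
by rewrite ffactnSr expnS; lia.
Qed.

Lemma hermite0 : hermite K 0 = 1.
Proof. by rewrite /hermite big_ord1 /= !expr0 divr1 alg_polyC scale1r. Qed.

Lemma hermite1 : hermite K 1 = 2%:R *: 'X.
Proof. by rewrite /hermite big_ord1 /= expr0 expr1 divr1 !scale1r. Qed.

Lemma coef_hermite_even p i :
  (hermite K (i + p.*2))`_i =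
  (i + p.*2)`!%:R * ((-1) ^+ p * 2%:R ^+ i / (p`! * i`!)%:R).
Proof. by rewrite coef_hermite leq_addr addKn odd_double doubleK. Qed.

Lemma coef_hermite_odd n i : odd (n + i) -> (hermite K n)`_i = 0.
Proof.
rewrite coef_hermite oddD => ni; case: leqP => [iN|]; last by rewrite mulr0.
by rewrite oddB // ni mulr0.
Qed.

Lemma coef_hermite_gt n i : (n < i)%N -> (hermite K n)`_i = 0.
Proof. by move=> ni; rewrite coef_hermite leqNgt ni mulr0. Qed.

Lemma hermite_rec n :
  hermite K n.+2 = 2%:R *: ('X * hermite K n.+1) - (2 * n.+1)%:R *: hermite K n.
Proof.
apply/polyP => i; rewrite coefB [X in X - _]coefZ [X in _ - X]coefZ coefXM.
have [ni|iN] := ltnP n.+2 i.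
  case: i ni => [|i] //= ni.
  by rewrite !coef_hermite_gt ?mulr0 ?subr0 //; lia.
have [od|ev] := boolP (odd (n.+2 + i)).
  have od' : odd (n + i) by move: od; rewrite /= negbK.
  case: i {iN} od od' => [|i] od od' /=; first by rewrite !coef_hermite_odd // !mulr0 subr0.
  rewrite [(hermite K n.+1)`__]coef_hermite_odd; last by move: od'; rewrite addnS addSn.
  by rewrite !coef_hermite_odd // !mulr0 subr0.
have := odd_double_half (n.+2 - i); rewrite oddB // -oddD (negPf ev) add0n.
(* Three cases remain: the leading coefficient i = n + 2, the constant term, to which the multiple
   of ['X] contributes nothing, and the coefficients in between. *)
case: _./2 => [|p] pE.
  have {pE} iE : i = n.+2 by lia.
  rewrite iE /= [(hermite K n)`__]coef_hermite_gt // mulr0 subr0.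
  have := coef_hermite_even 0 n.+2; have := coef_hermite_even 0 n.+1.
  rewrite !addn0 => -> ->; rewrite !factS !natrM exprS.
  by field; rewrite !natr_fact_neq0 addrC natr1 -natrD !pnatr_eq0.
case: i pE {iN ev} => [|i] pE /=.
  have nE : n = p.*2 by lia.
  have := coef_hermite_even p.+1 0; have := coef_hermite_even p 0.
  rewrite nE doubleS !add0n => -> ->; rewrite !factS !natrM -muln2.
  have e2 : (p * 2).+2%:R = 2 * (p%:R + 1) :> K by rewrite -addn2 natrD natrM; ring.
  have e1 : p.+1%:R = p%:R + 1 :> K by rewrite natr1.
  rewrite e1 e2 exprS; by field; rewrite natr1 !natr_fact_neq0 pnatr_eq0.
have nE : n = (i + p.*2).+1 by lia.
have := coef_hermite_even p.+1 i.+1; have := coef_hermite_even p i.+1.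
have := coef_hermite_even p.+1 i.
rewrite nE doubleS !addSn !addnS => -> -> ->; rewrite !factS !natrM -muln2.
have e3 : (i + p * 2).+3%:R = i%:R + 1 + 2 * (p%:R + 1) :> K.
  by rewrite -addn3 !natrD natrM; ring.
have e1 : p.+1%:R = p%:R + 1 :> K by rewrite natr1.
have e4 : i.+1%:R = i%:R + 1 :> K by rewrite natr1.
rewrite e1 e3 e4 !exprS; by field; rewrite !natr1 !natr_fact_neq0 !pnatr_eq0.
Qed.

Definition hermite_egf (x : K) n : K := (hermite K n).[x] / n`!%:R.

Lemma hermite_egf0 x : hermite_egf x 0 = 1.
Proof. by rewrite /hermite_egf hermite0 hornerC divr1. Qed.

Lemma hermite_egf1 x : hermite_egf x 1 = 2%:R * x.
Proof. by rewrite /hermite_egf hermite1 hornerZ hornerX divr1. Qed.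

Lemma hermite_egf_rec x n : n.+2%:R * hermite_egf x n.+2 =
  2%:R * x * hermite_egf x n.+1 - 2%:R * hermite_egf x n.
Proof.
rewrite /hermite_egf hermite_rec !(hornerD, hornerN, hornerZ, hornerM, hornerX).
rewrite !factS !natrM; field.
by rewrite !natr_fact_neq0 addrC natr1 -natrD !pnatr_eq0.
Qed.

(** Differentiation lowers the index, so a matrix of derivatives is a Toeplitz matrix up to row
    factors n! and column factors 2^j. *)
Lemma horner_derivn_hermite x n j :
  ((hermite K n)^`(j)).[x] = n`!%:R * (toep (hermite_egf x) n j * 2%:R ^+ j).
Proof.
rewrite derivn_hermite hornerZ /toep; case: leqP => [jn|nj]; last first.
  by rewrite ffact_small // muln0 mul0r mul0r mulr0.
rewrite /hermite_egf -(ffact_fact jn) !natrM natrX; field.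
exact: natr_fact_neq0.
Qed.

(* The logarithmic derivative of the generating function exp (2 x t - t^2). *)
Definition hermite_weight (x : K) : {poly K} := (2%:R * x)%:P + (- 2%:R) *: 'X.

Lemma hermite_egf_deriv x n :
  wcoef (hermite_egf x) (hermite_weight x) n = n.+1%:R * hermite_egf x n.+1.
Proof.
rewrite wcoef_linear; case: n => [|n].
  by rewrite hermite_egf0 hermite_egf1 addr0 mulr1 mul1r.
by rewrite hermite_egf_rec mulNr.
Qed.

End HermitePoly.

(** * Degrees and leading coefficients for a weight of degree one *)

Section LinearWeight.
Variable K : numFieldType.
Variables a b : K.
Let w : {poly K} := a%:P + b *: 'X.
Implicit Types (q : {poly K}) (s : nat).

Lemma wderiv_linear_top q s : (size q <= s.+1)%N ->
  (size (wderiv w q) <= s.+2)%N /\ (wderiv w q)`_s.+1 = b * q`_s.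
Proof.
move=> sq; have E n : (wderiv w q)`_n.+1 = q`_n.+2 *+ n.+2 + a * q`_n.+1 + b * q`_n.
  by rewrite /wderiv coefD coef_deriv mulrDl coefD coefCM -scalerAl coefZ coefXM addrA.
have q0 n : (s < n)%N -> q`_n = 0 by move=> sn; rewrite nth_default // (leq_trans sq).
split; last by rewrite E (q0 s.+2) // (q0 s.+1) // mulr0 mul0rn !add0r.
by apply/leq_sizeP => -[|n] // sn; rewrite E !q0 ?mulr0 ?mul0rn ?addr0 //; lia.
Qed.

Lemma weuler_linear_top c q s : (size q <= s.+1)%N ->
  (size (weuler w c q) <= s.+3)%N /\ (weuler w c q)`_s.+2 = b * q`_s.
Proof.
move=> sq; have [sd cd] := wderiv_linear_top sq.
have E n : (weuler w c q)`_n.+1 = (wderiv w q)`_n - c%:R * q`_n.+1.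
  by rewrite /weuler coefB coefXM coefZ.
split; last by rewrite E cd [q`_s.+2]nth_default ?mulr0 ?subr0 // (leq_trans sq).
apply/leq_sizeP => -[|n] // sn; rewrite E !nth_default ?mulr0 ?subr0 //.
  by apply: leq_trans sq _; lia.
exact: leq_trans sd _.
Qed.

Lemma foldr_weuler_linear_top cs q s : (size q <= s.+1)%N ->
  let P := foldr (weuler w) q cs in let S := (s + (size cs).*2)%N in
  (size P <= S.+1)%N /\ P`_S = b ^+ size cs * q`_s.
Proof.
move=> sq; elim: cs => [|c cs [sP cP]] /=; first by rewrite addn0 mul1r.
have [sE cE] := weuler_linear_top c sP.
by rewrite doubleS !addnS cE cP exprS mulrA.
Qed.

(** These polynomials times H are the successive derivatives of H; their degrees make them a graded
    basis. *)
Lemma iter_wderiv_linear j : b != 0 ->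
  size (iter j (wderiv w) 1) = j.+1 /\ lead_coef (iter j (wderiv w) 1) = b ^+ j.
Proof.
move=> b0; have [sj cj] : (size (iter j (wderiv w) 1%R) <= j.+1)%N /\
    (iter j (wderiv w) 1)`_j = b ^+ j.
  elim: j => [|j [sj cj]] /=; first by rewrite size_poly1 coefC.
  by have [] := wderiv_linear_top sj; rewrite cj exprS.
have sE : size (iter j (wderiv w) 1) = j.+1.
  apply/eqP; rewrite eqn_leq sj ltnNge; apply/negP => sj'.
  by have /eqP := cj; rewrite nth_default // eq_sym expf_eq0 (negPf b0) andbF.
by rewrite lead_coefE sE.
Qed.

End LinearWeight.

(** N! / M! is the product of N - c over c in {0,...,d}; split it over F and its complement, where c
    = d - g gives N - c = M + 1 + g. *)
Lemma fact_complement (K : numFieldType) F M : is_pos_set F -> (0 < size F)%N ->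
  let N := (M + (maxF F).+1)%N in
  N`!%:R = M`!%:R * \prod_(g <- IF F) (M.+1 + g)%:R
           * \prod_(f <- F) (N%:R - f%:R) :> K.
Proof.
move=> hF hk; set d := maxF F => N.
have Gd : forall g, g \in IF F -> (g <= d)%N by move=> g; rewrite mem_IF // => /and3P[].
have -> : \prod_(g <- IF F) (M.+1 + g)%:R =
    \prod_(c <- [seq (d - g)%N | g <- IF F]) (N%:R - c%:R) :> K.
  rewrite big_map; apply: eq_big_seq => g /Gd gd.
  by rewrite -natrB; [congr _%:R; rewrite /N; lia | rewrite /N; lia].
rewrite -mulrA [X in _ * X]mulrC -big_cat /= (perm_big _ (perm_complement hF hk)) /=.
rewrite (_ : \prod_(i <- _) _ = falling N%:R d.+1); last first.
  by rewrite /falling -(big_mkord xpredT (fun l => N%:R - l%:R)) /index_iota subn0.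
by rewrite falling_nat -natrM mulnC -(@ffact_fact N d.+1) ?leq_addl // addnK.
Qed.

(** * The Hermite identity multiplied by the minor of F *)

Section HermiteIdentity.
Variables (C : numClosedFieldType) (x : C).

Let y : C := - 'i * x.
Let w := hermite_weight x.
Let eta := hermite_egf x.

Let natr_fact_neq0 n : n`!%:R != 0 :> C.
Proof. by rewrite pnatr_eq0 -lt0n fact_gt0. Qed.

Let two_neq0 : 2%:R != 0 :> C. Proof. by rewrite pnatr_eq0. Qed.
Let i_neq0 : 'i != 0 :> C. Proof. exact: neq0Ci. Qed.
Let i2 : 'i * 'i = -1 :> C. Proof. by rewrite -expr2 sqrCi. Qed.

(** The coefficients of 1 / H(t) = exp (- 2 x t + t^2), obtained from exp (2 y s - s^2) with s = - i
    t and y = - i x. *)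
Definition hermite_dual n : C := (- 'i) ^+ n * hermite_egf y n.

Lemma hermite_dual_inverse : conv_inverse eta hermite_dual.
Proof.
apply: (@conv_inverse_wderiv _ w).
- exact: hermite_egf0.
- by rewrite /hermite_dual hermite_egf0 mulr1.
- exact: hermite_egf_deriv.
move=> n; rewrite wcoef_linear /hermite_dual; case: n => [|n].
  rewrite hermite_egf0 hermite_egf1 /y expr1 expr0 addr0.
  transitivity (2%:R * x * - ('i * 'i)); first by rewrite i2; ring.
  ring.
rewrite [in RHS]mulrCA hermite_egf_rec /y !exprS.
move: ((- 'i) ^+ n) (hermite_egf _ _) (hermite_egf _ _) => z v u.
transitivity (- ('i * 'i) * (2%:R * x * (- 'i * z * u)) + ('i * 'i) * (2%:R * (z * v))).
  by rewrite i2; ring.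
ring.
Qed.

(* The normalised moments of the Gaussian weight exp (2 x t - t^2); [ell S q] is
   the integral of q against it whenever size q <= S, so it kills derivatives. *)
Let mu n : C := ('i / 2%:R) ^+ n * (hermite C n).[y].

(** Integration by parts for t^n exp (2 x t - t^2), here a form of the three-term recurrence at y.
    For n = 0 the last term has coefficient zero. *)
Let mu_rec n : 2%:R * mu n.+1 = 2%:R * x * mu n + n%:R * mu n.-1.
Proof.
rewrite /mu; case: n => [|n] /=.
  rewrite hermite0 hermite1 hornerC hornerZ hornerX /y expr1 expr0 mul0r addr0.
  transitivity (- ('i * 'i) * (2%:R * x)); last by rewrite i2; ring.
  by field.
rewrite hermite_rec natrM !exprS; move: (hermite _ _) (hermite _ _) => p q.
rewrite !(hornerD, hornerN, hornerZ, hornerM, hornerX) /y.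
move: (('i / 2) ^+ n) (p.[_]) (q.[_]) => z u v.
transitivity (- ('i * 'i) * (2%:R * x * ('i / 2%:R * z * v)) - ('i * 'i) * (n.+1%:R * (z * u))).
  by field.
by rewrite i2; ring.
Qed.

Let ell S (q : {poly C}) : C := \sum_(i < S) q`_i * mu i.

Let ellD S p q : ell S (p + q) = ell S p + ell S q.
Proof. by rewrite -big_split; apply: eq_bigr => i _; rewrite coefD mulrDl. Qed.

Let ellZ S c p : ell S (c *: p) = c * ell S p.
Proof. by rewrite mulr_sumr; apply: eq_bigr => i _; rewrite coefZ mulrA. Qed.

Let ell0 S : ell S 0 = 0.
Proof. by rewrite /ell big1 // => i _; rewrite coef0 mul0r. Qed.

Let ell_sum (I : finType) S (q : I -> {poly C}) : ell S (\sum_i q i) = \sum_i ell S (q i).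
Proof. by elim/big_rec2: _ => [|i u v _ <-]; rewrite ?ell0 ?ellD. Qed.

Let ellXn S n : (n < S)%N -> ell S 'X^n = mu n.
Proof.
move=> nS; rewrite /ell (bigD1 (Ordinal nS)) //= coefXn eqxx mul1r big1 ?addr0 // => i.
by rewrite -val_eqE /= coefXn => /negPf->; rewrite mul0r.
Qed.

Let ell_wderiv S (q : {poly C}) : (size q < S)%N -> ell S (wderiv w q) = 0.
Proof.
move=> qS.
have -> : wderiv w q = \sum_(i < size q) q`_i *: wderiv w 'X^i.
  transitivity (wderiv w (\sum_(i < size q) q`_i *: 'X^i)).
    by rewrite -poly_def coefK.
  rewrite /wderiv raddf_sum mulr_sumr -big_split /=.
  by apply: eq_bigr => i _; rewrite derivZ -scalerAr scalerDr.
rewrite ell_sum big1 // => i _; rewrite ellZ.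
have iS : (i.+1 < S)%N := leq_ltn_trans (ltn_ord i) qS.
have -> : wderiv w 'X^i = i%:R *: 'X^(i.-1) + (2%:R * x) *: 'X^i + (- 2%:R) *: 'X^(i.+1).
  by rewrite /wderiv derivXn -scaler_nat mulrDl mul_polyC -scalerAl exprS addrA.
rewrite !ellD !ellZ !ellXn //; [|by lia..].
by rewrite mulNr mu_rec; ring.
Qed.

(** Integrating by parts j times moves the derivatives from H onto t^g; for j > g both sides
    vanish. *)
Let ell_basis S g j : (g + j < S)%N ->
  ell S ('X^g * iter j (wderiv w) 1) = (-1) ^+ j * (g ^_ j)%:R * mu (g - j).
Proof.
elim: j g => [|j IHj] g gS.
  by rewrite mulr1 ellXn ?ffactn0 ?mul1r ?subn0 // -[g]addn0.
set u := iter j (wderiv w) 1.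
have su : size u = j.+1.
  by have [] := @iter_wderiv_linear C (2%:R * x) (- 2%:R) j; rewrite // oppr_eq0.
have E : 'X^g * wderiv w u = wderiv w ('X^g * u) + (- g%:R) *: ('X^(g.-1) * u).
  by rewrite /wderiv derivM derivXn -scaler_nat scaleNr -scalerAl; ring.
rewrite [iter _ _ _]/= E ellD ell_wderiv ?add0r ?ellZ; last first.
  by apply: leq_ltn_trans (size_polyMleq _ _) _; rewrite size_polyXn su addSnnS addnS.
case: g gS {E} => [|g] gS; first by rewrite ffact0n oppr0 !mul0r mulr0 mul0r.
rewrite IHj ?ffactnS ?natrM ?exprS ?subSS; first by ring.
by move: gS; lia.
Qed.

Variables (F : seq nat) (M : nat).
Hypotheses (hF : is_pos_set F) (hk : (0 < size F)%N).
Let G := IF F.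
Let k := size F.
Let m := size G.
Let d := maxF F.
Let N := (M + d.+1)%N.

Let degs p (r : nat) : nat := nth 0%N (p :: F) r.

Let L p : 'M[C]_k.+1 := \matrix_(r, j) ((hermite C (degs p r))^`(j)).[x].

Let Nm : 'M[C]_m.+1 := \matrix_(r, j)
    (if (r : nat) is l.+1 then ((hermite C (nth 0%N G l))^`(j)).[y]
     else (- 'i) ^+ j * (hermite C (M + j)).[x]).

Let A : {poly C} := \sum_(j < k.+1) (cofactor (L N) 0 j * 2%:R ^+ j) *: 'X^j.

(** The cofactors along the first row do not involve p, so the single polynomial A, built at N,
    serves every p. *)
Let wcoefA p : p`!%:R * wcoef eta A p = \det (L p).
Proof.
rewrite (expand_det_row _ 0) wcoef_sum mulr_sumr; apply: eq_bigr => j _.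
rewrite wcoefZ -['X^j]mul1r wcoefMXn mxE /degs /= horner_derivn_hermite.
rewrite -polyC1 wcoefC mul1r -/(toep eta p j).
have -> : cofactor (L p) 0 j = cofactor (L N) 0 j.
  rewrite /cofactor; congr (_ * \det _).
  by apply/matrixP => r c; rewrite !mxE.
ring.
Qed.

(** For p = f the first row of [L p] repeats the row of f. *)
Let wcoefA_F f : f \in F -> wcoef eta A f = 0.
Proof.
move=> /(nthP 0%N)[l lk fE]; apply: (mulfI (natr_fact_neq0 f)); rewrite mulr0 wcoefA.
apply: (determinant_alternate (i1 := 0) (i2 := lift 0 (Ordinal lk))) => // j.
by rewrite !mxE /degs /= fE.
Qed.

Definition hermite_minor : C := \det (\matrix_(l < k, j < k) toep eta (nth 0%N F l) j).

Let cofL : cofactor (L N) 0 ord_max = (-1) ^+ k *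
  (\prod_(f <- F) f`!%:R * (2%:R ^+ 'C(k, 2) * hermite_minor)).
Proof.
rewrite /cofactor add0n; congr (_ * _).
rewrite -bin2_sum big_mkord -prodrXr -det_scale_cols.
rewrite (big_nth 0%N) big_mkord -det_scale_rows; congr (\det _).
apply/matrixP => l j; rewrite !mxE /degs /= horner_derivn_hermite.
by rewrite /bump leqNgt ltn_ord.
Qed.

Let A_top : (size A <= k.+1)%N /\ A`_k = cofactor (L N) 0 ord_max * 2%:R ^+ k.
Proof.
have -> : A = \poly_(j < k.+1) (cofactor (L N) 0 (inord j) * 2%:R ^+ j).
  by rewrite poly_def; apply: eq_bigr => j _; rewrite inord_val.
rewrite size_poly coef_poly ltnSn; split=> //; congr (cofactor _ _ _ * _).
by apply: val_inj; rewrite /= inordK.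
Qed.

Let cofN : cofactor Nm 0 ord_max = (-1) ^+ m *
  (\prod_(g <- G) g`!%:R * (2%:R ^+ 'C(m, 2) *
     \det (\matrix_(l < m, j < m) toep (hermite_egf y) (nth 0%N G l) j))).
Proof.
rewrite /cofactor add0n; congr (_ * _).
rewrite -bin2_sum big_mkord -prodrXr -det_scale_cols.
rewrite (big_nth 0%N) big_mkord -det_scale_rows; congr (\det _).
apply/matrixP => l j; rewrite !mxE /= horner_derivn_hermite.
by rewrite /bump leqNgt ltn_ord.
Qed.

(** The factor i^(g - j) relating the two families splits over rows and columns; the total exponent
    is sum G - binom(m, 2) = u_G + m. *)
Let det_dual :
  \det (\matrix_(l < m, j < m) toep (hermite_egf y) (nth 0%N G l) j) =
  'i ^+ (uF G + m) * \det (\matrix_(l < m, j < m) toep hermite_dual (nth 0%N G l) j).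
Proof.
have gG : ('C(m.+1, 2) <= sumn G)%N.
  apply: sumn_pos_set; first exact: IF_sorted.
  by apply/allP => g; rewrite mem_IF // => /and3P[].
have nz : 'i ^+ 'C(m, 2) != 0 :> C by rewrite expf_neq0.
apply: (mulfI nz); rewrite mulrA -exprD.
have -> : ('C(m, 2) + (uF G + m) = sumn G)%N.
  by move: gG; rewrite /uF -/m binS bin1; lia.
rewrite -bin2_sum big_mkord -prodrXr -det_scale_cols.
rewrite sumnE (big_nth 0%N) big_mkord -prodrXr -det_scale_rows; congr (\det _).
apply/matrixP => l j; rewrite !mxE /toep; case: ifP => [jl|_]; last by rewrite mul0r mulr0.
move: (nth 0%N G l) jl => g jl; rewrite /hermite_dual mulrA mulrC.
have -> : 'i ^+ g = 'i ^+ (g - j) * 'i ^+ j :> C by rewrite -exprD subnK.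
by rewrite [X in _ = X * _]mulrAC -exprMn mulrN i2 opprK expr1n mul1r.
Qed.

Let wcoef_basis j p : p`!%:R * wcoef eta (iter j (wderiv w) 1) p = (hermite C (p + j)).[x].
Proof.
elim: j p => [|j IHj] p.
  by rewrite -polyC1 wcoefC mul1r addn0 mulrC divfK.
rewrite /= (wcoef_wderiv (hermite_egf_deriv x)) mulrA.
by rewrite [_ * p.+1%:R]mulrC -natrM -factS IHj addSnnS.
Qed.

(* Both sides carry the factor [hermite_minor], a nonzero polynomial in x that
   may vanish at the given point. *)
Lemma hermite_identity_minor :
  \det (L N) * hermite_minor =
  'i ^+ uF G * (2%:R ^+ 'C(k.+1, 2) / 2%:R ^+ 'C(m, 2)) *
  ((VF F)%:R / (VF G)%:R) * \prod_(f <- F) (f%:R - N%:R) *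
  \det Nm * hermite_minor.
Proof.
have Gd g : g \in G -> (g <= d)%N by rewrite mem_IF // => /and3P[].
have kmE : (k + m)%N = d.+1 := size_complement hF hk.
have [B [BE wcoefB BW]] := weuler_quotient (hermite_egf0 x) (hermite_egf_deriv x)
  (perm_complement hF hk) Gd wcoefA_F.
have [sA Ak] := A_top.
have [sP cP] := foldr_weuler_linear_top (2%:R * x) (- 2%:R)
  [seq (d - g)%N | g <- G] sA.
move: sP cP; rewrite -/(hermite_weight x) -BE size_map -/m.
(* A has degree at most k and each of the m Euler factors adds at most 2, so after division by
   ['X^(d.+1)] the degree of B is at most m. *)
have -> : (k + m.*2 = m + d.+1)%N by rewrite -kmE; lia.
move=> sP cP.
have B_m : B`_m = (- 2%:R) ^+ m * A`_k.
  by rewrite -cP coefMXn ltnNge leq_addl /= addnK.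
have sB : (size B <= m.+1)%N.
  apply/leq_sizeP => i mi; have mi' : (m + d.+1 < i + d.+1)%N by rewrite ltn_add2r.
  by have /leq_sizeP/(_ _ mi') := sP; rewrite coefMXn ltnNge leq_addl /= addnK.
have two0 : - 2%:R != 0 :> C by rewrite oppr_eq0.
have [j|b [Bb bm]] := @basis_decomposition C (fun j => iter j (wderiv w) 1) m B _ sB.
  by have [] := iter_wderiv_linear (2%:R * x) j two0.
have [_ lm] := iter_wderiv_linear (2%:R * x) m two0.
(* The factor (-2)^m gained through the Euler operators is also the leading coefficient of the last
   basis element. *)
have {bm} bm : b m = A`_k.
  move: bm; rewrite lm B_m mulrC; apply: mulfI; exact: expf_neq0.
have mi0 j : (- 'i) ^+ j != 0 :> C by rewrite expf_neq0 // oppr_eq0.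
(* The division compensates the powers of - i in the first row of [Nm]. *)
pose bv : 'cV[C]_m.+1 := \col_j (b j / (- 'i) ^+ j).
have Nb r : (Nm *m bv) r 0 = (r == 0)%:R * (M`!%:R * wcoef eta B M).
  rewrite mxE; case: (unliftP 0 r) => [l ->|->]; last first.
    rewrite eqxx mul1r Bb wcoef_sum mulr_sumr; apply: eq_bigr => j _.
    rewrite !mxE /= wcoefZ [RHS]mulrCA wcoef_basis.
    by rewrite mulrC mulrA divfK.
  rewrite mul0r; have [|W [gB _]] := BW (nth 0%N G l); first by rewrite mem_nth.
  move: gB; set g := nth 0%N G l => gB.
  pose S := (size W + g + m).+2.
  have ellW : ell S ('X^g * B) = 0.
    by rewrite gB ell_wderiv // /S -!addnA ltnS leqW // leq_addr.
  (* This factor turns the row of g times [bv] into the integral of t^g B H, which is zero. *)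
  apply: (mulfI (x := ('i / 2%:R) ^+ g)); first by rewrite expf_neq0 // mulf_neq0 ?invr_eq0.
  transitivity (ell S ('X^g * B)); last by rewrite ellW mulr0.
  rewrite Bb mulr_sumr mulr_sumr ell_sum; apply: eq_bigr => j _.
  rewrite -scalerAr ellZ ell_basis; last by have := ltn_ord j; rewrite /S; lia.
  rewrite !mxE /= -/g derivn_hermite hornerZ /mu natrM natrX.
  have [jg|gj] := leqP j g; last by rewrite ffact_small // !(mulr0, mul0r).
  rewrite -{1}(subnK jg) exprD.
  have -> : (- 'i) ^+ j = (-1) ^+ j * 'i ^+ j :> C by rewrite -exprMn mulN1r.
  have ss : (-1) ^+ j * (-1) ^+ j = 1 :> C by rewrite -expr2 sqrr_sign.
  rewrite [('i / 2%:R) ^+ j]expr_div_n.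
  have s0 : (-1) ^+ j != 0 :> C by rewrite signr_eq0.
  have I0 : 'i ^+ j != 0 :> C by rewrite expf_neq0.
  have T0 : 2%:R ^+ j != 0 :> C by rewrite expf_neq0.
  move: ((-1) ^+ j) ('i ^+ j) (2%:R ^+ j) ss s0 I0 T0 => s I T ss s0 I0 T0.
  move: (('i / 2%:R) ^+ (g - j)) ((hermite C (g - j)).[y]) (b j) ((g ^_ j)%:R) => z h c p.
  transitivity (s * s * (z * (I / T) * (T * p * h * (c / (s * I))))); first by rewrite ss mul1r.
  by field; rewrite s0 I0 T0.
have := cramer_first_row Nb ord_max.
rewrite [bv _ _]mxE [_ ord_max]/= bm Ak cofL cofN det_dual wcoefB.
set wA := wcoef _ A _ => E.
have wAE : N`!%:R * wA = \det (L N) := wcoefA N.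
have factE : N`!%:R = _ :> C := fact_complement C M hF hk.
have DE : hermite_minor = _ := det_toep_complement hF hk (hermite_egf0 x) hermite_dual_inverse.
have gG : ('C(m.+1, 2) <= sumn G)%N.
  apply: sumn_pos_set; first exact: IF_sorted.
  by apply/allP => g; rewrite mem_IF // => /and3P[].
have sgn : (-1) ^+ (sumn G + 'C(m, 2)) = 'i ^+ uF G * 'i ^+ uF G * ('i ^+ m * 'i ^+ m) :> C.
  rewrite -!exprMn i2 -exprD -[LHS]signr_odd -[RHS]signr_odd; congr (_ ^+ _).
  by move: gG; rewrite /uF -/m binS bin1; lia.
have imE : (- 'i) ^+ m * (-1) ^+ m = 'i ^+ m :> C by rewrite -exprMn mulrN1 opprK.
have prodE : \prod_(f <- F) (f%:R - N%:R) = (-1) ^+ k * \prod_(f <- F) (N%:R - f%:R) :> C.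
  rewrite /k; elim: (F) => [|f s IHs]; first by rewrite !big_nil mulr1.
  by rewrite !big_cons IHs exprS; ring.
(* Only the left minor is replaced by the dual one, which sits in the cofactor of [Nm]; the right
   one is matched by the coordinate [b m]. *)
rewrite {1}DE prodE sgn -mulrA.
have Pg0 : \prod_(g <- G) g`!%:R != 0 :> C := prod_fact_neq0 _ _.
have Pf0 : \prod_(f <- F) f`!%:R != 0 :> C := prod_fact_neq0 _ _.
have VG0 : (VF G)%:R != 0 :> C := VF_neq0 _ (IF_sorted F).
have T0 j : 2%:R ^+ j != 0 :> C by rewrite expf_neq0.
have I0 j : 'i ^+ j != 0 :> C by rewrite expf_neq0.
have mim : (- 'i) ^+ m != 0 :> C by [].
have sm : (-1) ^+ m != 0 :> C by rewrite signr_eq0.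
rewrite binS bin1 -/k [2%:R ^+ (_ + _)]exprD -/G -/m.
move: E factE; rewrite -wAE -/G -imE exprD => E ->.
set De := \det (\matrix_(l, j) toep hermite_dual _ _) in E *.
set Pf' := \prod_(f <- F) (N%:R - f%:R); set Pg' := \prod_(g <- G) (_ + g)%:R in E *.
move: Pg0 Pf0 VG0 (T0 'C(k, 2)) (T0 'C(m, 2)) (I0 m) (I0 (uF G)) mim sm E.
rewrite -imE; move: (_ ^+ m) (_ ^+ m) (_ ^+ k) (_ ^+ k) (_ ^+ uF G) => v n kap Tk I.
move: (\prod_(_ <- G) _) (\prod_(_ <- F) _) (_ ^+ 'C(k, 2)) (_ ^+ 'C(m, 2)) => pg pf T Tm.
move: (VF F)%:R (VF G)%:R M`!%:R (\det Nm) hermite_minor => vF vG Mf X D.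
move=> pg0 pf0 vG0 T_0 Tm0 nv0 I_0 n0 v0 E.
transitivity (v * (pg * (Tm * (I * (n * v) * De))) * (Mf * (Pg' * wA)) *
  (Pf' * I * n * vF / (vG * pf * Tm))); first by field; rewrite Tm0 vG0 pf0.
by rewrite -E; field; rewrite Tm0 vG0 pf0.
Qed.

End HermiteIdentity.

(** * Charlier polynomials *)

Section CharlierPoly.
Variable K : numFieldType.
Implicit Types (a x : K).

Let natr_fact_neq0 n : n`!%:R != 0 :> K.
Proof. by rewrite pnatr_eq0 -lt0n fact_gt0. Qed.

Lemma charlierE a n x :
  charlier a n x = \sum_(j < n.+1) (- a) ^+ (n - j) / (n - j)`!%:R * gbinom x j.
Proof.
rewrite /charlier mulr_sumr; apply: eq_bigr => j _.
have jn : (j <= n)%N by rewrite -ltnS.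
have := natr_fact_neq0 j; have := natr_fact_neq0 (n - j).
rewrite -(bin_fact jn) !natrM => h1 h2; field.
by rewrite h1 h2 pnatr_eq0 -lt0n bin_gt0.
Qed.

Lemma gbinomS x j : gbinom (x + 1) j.+1 = gbinom x j.+1 + gbinom x j.
Proof.
have E i : falling (x + 1) i.+1 = falling x i.+1 + i.+1%:R * falling x i.
  rewrite /falling; elim: i => [|i IHi].
    by rewrite !big_ord_recr !big_ord0 /=; ring.
  rewrite big_ord_recr /= IHi !big_ord_recr /= -!natr1.
  by move: (\prod_(_ < i) _) => p; ring.
rewrite /gbinom E factS natrM; field.
by rewrite natr_fact_neq0 addrC natr1 pnatr_eq0.
Qed.

Lemma charlier0 a x : charlier a 0 x = 1.
Proof. by rewrite charlierE big_ord1 /gbinom /falling big_ord0 expr0 !divr1 mulr1. Qed.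

(** Raising x by one multiplies the generating function by 1 + t. *)
Lemma charlierS a n x : charlier a n.+1 (x + 1) = charlier a n.+1 x + charlier a n x.
Proof.
rewrite !charlierE big_ord_recl [in RHS]big_ord_recl /= -addrA; congr (_ + _).
  by rewrite /gbinom /falling !big_ord0.
rewrite -big_split; apply: eq_bigr => j _ /=.
by rewrite /bump add1n subSS gbinomS mulrDr.
Qed.

Lemma toep_charlierS a n x i : toep (fun n => charlier a n (x + 1)) n i =
  toep (fun n => charlier a n x) n i + toep (fun n => charlier a n x) n i.+1.
Proof.
rewrite /toep; case: (ltngtP i n) => [lin|//|->]; last first.
- by rewrite subnn !charlier0 addr0.
- by rewrite addr0.
by rewrite -(subnSK lin) charlierS.
Qed.

Lemma charlier_addn a n x j : charlier a n (x + j%:R) =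
  \sum_(i < j.+1) toep (fun n => charlier a n x) n i * 'C(j, i)%:R.
Proof.
elim: j x => [|j IHj] x.
  by rewrite big_ord1 addr0 bin0 mulr1 /toep subn0.
rewrite -natr1 [_ + 1]addrC addrA IHj.
under eq_bigr do rewrite toep_charlierS mulrDl.
rewrite big_split [in RHS]big_ord_recl /=.
under [X in _ = _ + X]eq_bigr do rewrite /bump add1n binS natrD mulrDr.
rewrite big_split /= addrA; congr (_ + _).
rewrite [X in _ = _ + X]big_ord_recr /= (@bin_small j j.+1) // mulr0 addr0.
by rewrite [LHS]big_ord_recl !bin0.
Qed.

(** By [charlier_addn] the shifts of the argument become shifts of the index through a unitriangular
    matrix of binomial coefficients. *)
Lemma det_charlier a x F :
  \det (\matrix_(l < size F, j < size F) charlier a (nth 0%N F l) (x + j%:R)) =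
  \det (\matrix_(l < size F, j < size F) toep (fun n => charlier a n x) (nth 0%N F l) j).
Proof.
set k := size F; pose T : 'M[K]_k := \matrix_(i, j) 'C(j, i)%:R.
rewrite -[RHS](@det_unitrig_cols _ _ _ T) => [|i j ij|i]; first last.
- by rewrite mxE binn.
- by rewrite mxE bin_small.
congr (\det _); apply/matrixP => l j; rewrite !mxE charlier_addn.
rewrite (big_ord_widen k (fun i => toep (fun n => charlier a n x) (nth 0%N F l) i * 'C(j, i)%:R)) //.
rewrite big_mkcond; apply: eq_bigr => i _; rewrite !mxE.
by case: ltnP => // ji; rewrite bin_small ?mulr0.
Qed.

Definition exp_seq a n : K := a ^+ n / n`!%:R.

Lemma exp_seq0 a : exp_seq a 0 = 1. Proof. by rewrite /exp_seq expr0 divr1. Qed.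

Lemma exp_seq_deriv a n :
  wcoef (exp_seq a) a%:P n = n.+1%:R * exp_seq a n.+1.
Proof.
rewrite wcoefC /exp_seq exprS factS natrM; field.
by rewrite natr_fact_neq0 addrC natr1 pnatr_eq0.
Qed.

Lemma gbinom_nat s j : gbinom (s%:R : K) j = 'C(s, j)%:R.
Proof.
rewrite /gbinom falling_nat -bin_ffact natrM mulfK //.
Qed.

(** At a natural number s the factor (1 + t)^s is a polynomial, so the Charlier generating function
    fits the weighted calculus with H = exp (- a t). *)
Lemma wcoef_charlier a s n :
  wcoef (exp_seq (- a)) ((1 + 'X) ^+ s) n = charlier a n s%:R.
Proof.
rewrite charlierE; apply: eq_bigr => j _; rewrite gbinom_nat mulrC; congr (_ * _).
rewrite exprDn coef_sum; under eq_bigr do rewrite expr1n mul1r coefMn coefXn.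
have [js|sj] := leqP j s.
  rewrite (bigD1 (Ordinal (js : (j < s.+1)%N))) //= eqxx big1 ?addr0 // => i.
  by rewrite -val_eqE /= eq_sym => /negPf->; rewrite mul0rn.
rewrite bin_small // big1 // => i _; rewrite gtn_eqF ?mul0rn //.
exact: leq_ltn_trans (leq_ord i) sj.
Qed.

(** The inverse of (1 + t)^s exp (- a t) is (1 + t)^(-s) exp (a t). The induction step moves one
    factor 1 + t from one series to the other. *)
Lemma charlier_inverse a s : conv_inverse (fun n => charlier a n s%:R)
  (fun n => charlier (- a) n (- s%:R)).
Proof.
elim: s => [|s IHs].
  have E b n : charlier b n 0 = exp_seq (- b) n.
    rewrite charlierE big_ord_recl /= subn0 /gbinom /falling big_ord0 invr1 !mulr1.
    by rewrite big1 ?addr0 // => j _; rewrite big_ord_recl subrr mul0r mul0r mulr0.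
  have := @conv_inverse_wderiv K (- a)%:P (exp_seq (- a)) (exp_seq a)
    (exp_seq0 _) (exp_seq0 _) (exp_seq_deriv _).
  rewrite /conv_inverse /conv => H n; rewrite -H => [|p].
    by apply: eq_bigr => i _; rewrite oppr0 !E opprK.
  by rewrite -exp_seq_deriv !wcoefC mulNr.
have e_rec n : charlier (- a) n.+1 (- s%:R) =
    charlier (- a) n.+1 (- s.+1%:R) + charlier (- a) n (- s.+1%:R).
  by rewrite -charlierS -natr1 opprD addrNK.
case=> [|n]; first by rewrite /conv big_ord1 !charlier0 mulr1.
pose S1 := \sum_(i < n.+2) charlier a (n.+1 - i) s%:R * charlier (- a) i (- s.+1%:R).
pose S2 := \sum_(i < n.+1) charlier a (n - i) s%:R * charlier (- a) i (- s.+1%:R).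
rewrite -IHs /conv; transitivity (S1 + S2).
  rewrite /S1 [LHS]big_ord_recr [X in _ = X + _]big_ord_recr /= subnn !charlier0.
  rewrite addrAC; congr (_ + _); rewrite -big_split; apply: eq_bigr => i _ /=.
  by have := charlierS a (n - i) s%:R; rewrite natr1 subSn ?leq_ord // => ->; rewrite mulrDl.
rewrite /S1 [RHS]big_ord_recl [X in X + _]big_ord_recl /= !charlier0 -addrA; congr (_ + _).
rewrite -big_split; apply: eq_bigr => i _ /=.
by rewrite /bump add1n subSS e_rec mulrDr.
Qed.

Definition charlier_poly a n : {poly K} :=
  \sum_(j < n.+1) ((- a) ^+ (n - j) / (n - j)`!%:R / j`!%:R) *: falling_poly K j.

Lemma horner_charlier_poly a n x : (charlier_poly a n).[x] = charlier a n x.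
Proof.
rewrite horner_sum charlierE; apply: eq_bigr => j _.
by rewrite hornerZ horner_falling_poly /gbinom mulrAC mulrA.
Qed.

Lemma size_charlier_poly a n : (size (charlier_poly a n) <= n.+1)%N.
Proof.
rewrite (leq_trans (size_sum _ _ _)) //; apply/bigmax_leqP => j _.
by rewrite (leq_trans (size_scale_leq _ _)) // size_falling_poly.
Qed.

Lemma coef_charlier_poly a n : (charlier_poly a n)`_n = n`!%:R^-1.
Proof.
rewrite coef_sum big_ord_recr /= subnn big1 => [|j _]; last first.
  by rewrite coefZ [(falling_poly _ _)`__]nth_default ?mulr0 // size_falling_poly.
have /monicP := falling_poly_monic K n; rewrite lead_coefE size_falling_poly /=.
by rewrite add0r coefZ => ->; rewrite expr0 mulr1 divr1 mul1r.
Qed.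

End CharlierPoly.

(** * The Charlier identity at large natural numbers, multiplied by the minor of F *)

Section CharlierIdentity.
Variables (K : numFieldType) (a : K).
Hypothesis a0 : a != 0.

Let w : {poly K} := (- a)%:P.
Let eta := exp_seq (- a).
Let sg : {poly K} := 1 + 'X.

Let natr_fact_neq0 n : n`!%:R != 0 :> K.
Proof. by rewrite pnatr_eq0 -lt0n fact_gt0. Qed.

Let an0 n : a ^+ n != 0. Proof. by rewrite expf_neq0. Qed.

Let sgE : sg = 'X - (-1)%:P. Proof. by rewrite polyCN opprK addrC. Qed.

Let sg_size n : size (sg ^+ n) = n.+1.
Proof. by rewrite sgE size_exp_XsubC. Qed.

Let sg_lead n : lead_coef (sg ^+ n) = 1.
Proof. by rewrite sgE; apply/monicP; rewrite monic_exp // monicXsubC. Qed.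

(* The normalised integral of q(t) exp (- a (1 + t)) over [-1, +oo),
   computed termwise in powers of 1 + t. *)
Let ell S (q : {poly K}) : K :=
  \sum_(i < S) (q \Po ('X - 1))`_i * (i`!%:R / a ^+ i).

Let ellD S p q : ell S (p + q) = ell S p + ell S q.
Proof. by rewrite -big_split; apply: eq_bigr => i _; rewrite comp_polyD coefD mulrDl. Qed.

Let ellZ S c p : ell S (c *: p) = c * ell S p.
Proof. by rewrite mulr_sumr; apply: eq_bigr => i _; rewrite comp_polyZ coefZ -mulrA. Qed.

Let ell0 S : ell S 0 = 0.
Proof. by rewrite /ell big1 // => i _; rewrite comp_poly0 coef0 mul0r. Qed.

Let ell_sum n S (q : 'I_n -> {poly K}) : ell S (\sum_i q i) = \sum_i ell S (q i).
Proof. by elim/big_rec2: _ => [|i u v _ <-]; rewrite ?ell0 ?ellD. Qed.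

(** The integral of a derivative is minus its boundary term at -1, hence the condition on q.
    Termwise, the sum telescopes. *)
Let ell_wderiv S (q : {poly K}) : (size q <= S)%N -> q.[-1] = 0 ->
  ell S (wderiv w q) = 0.
Proof.
move=> qS q1; set Q := q \Po ('X - 1).
have QE : wderiv w q \Po ('X - 1) = Q^`() - a *: Q.
  rewrite /wderiv comp_polyD comp_polyM comp_polyC deriv_comp derivB derivX.
  by rewrite -[1]/(1%:P) derivC subr0 mulr1 mul_polyC scaleNr.
have QS : Q`_S = 0.
  by rewrite nth_default // /Q size_comp_poly2 // -polyC1 size_XsubC.
have Q0 : Q`_0 = 0.
  by rewrite -horner_coef0 horner_comp hornerD hornerN hornerX hornerC sub0r.
pose T i := Q`_i * (i`!%:R / a ^+ i) * a.
transitivity (\sum_(0 <= i < S) (T i.+1 - T i)).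
  rewrite big_mkord; apply: eq_bigr => i _; rewrite QE coefB coef_deriv coefZ /T.
  rewrite factS natrM exprS -mulr_natl; field.
  by rewrite an0 a0.
by rewrite telescope_sumr // /T QS Q0 !mul0r subrr.
Qed.

(** Expand t^g in powers of 1 + t and integrate termwise; the factorials (i + p)! / p! are, up to
    sign, falling factorials of - p - 1. *)
Let ell_basis S g p : (g + p < S)%N ->
  ell S ('X^g * sg ^+ p) =
  (-1) ^+ g * (g`!%:R * p`!%:R) / a ^+ (g + p) * charlier (- a) g (- p%:R - 1).
Proof.
move=> gpS.
have comp : ('X^g * sg ^+ p) \Po ('X - 1) =
    \sum_(i < g.+1) ((-1) ^+ (g - i) * 'C(g, i)%:R) *: 'X^(i + p).
  have sgT : sg \Po ('X - 1) = 'X.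
    by rewrite /sg -polyC1 comp_polyD comp_polyX comp_polyC addrC subrK.
  rewrite comp_polyM !rmorphXn /= comp_polyX sgT ['X - 1]addrC exprDn mulr_suml.
  apply: eq_bigr => i _.
  rewrite mulrnAl -mulrA -exprD -mul_polyC rmorphM rmorphXn /= polyCN polyC1.
  by rewrite polyC_natr -mulrA [_%:R * _]mulr_natl mulrnAr.
transitivity (\sum_(i < g.+1) (-1) ^+ (g - i) * 'C(g, i)%:R *
    ((i + p)`!%:R / a ^+ (i + p)) : K).
  rewrite /ell comp; under eq_bigr do rewrite coef_sum mulr_suml.
  rewrite exchange_big; apply: eq_bigr => i _ /=.
  have ipS : (i + p < S)%N by apply: leq_ltn_trans gpS; rewrite leq_add2r leq_ord.
  rewrite (bigD1 (Ordinal ipS)) //= coefZ coefXn eqxx mulr1 big1 ?addr0 // => j.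
  by rewrite -val_eqE /= coefZ coefXn => /negPf->; rewrite mulr0 mul0r.
rewrite charlierE mulr_sumr; apply: eq_bigr => i _.
have ig : (i <= g)%N := leq_ord i.
have fE : falling (- p%:R - 1) i = (-1) ^+ i * (i + p)`!%:R / p`!%:R :> K.
  elim: (i : nat) => [|j IHj].
    by rewrite /falling big_ord0 mul1r divff.
  rewrite /falling big_ord_recr /= -/(falling _ _) IHj exprS addSn factS natrM -natr1 natrD.
  by field.
rewrite /gbinom fE opprK -(bin_fact ig) !natrM.
have -> : a ^+ (i + p) = a ^+ (g + p) / a ^+ (g - i).
  by apply: (mulIf (an0 (g - i))); rewrite divfK // -exprD; congr (_ ^+ _); lia.
have -> : (-1) ^+ (g - i) = (-1) ^+ g * (-1) ^+ i :> K.
  by rewrite -exprD -[LHS]signr_odd -[RHS]signr_odd oddB // oddD.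
by field; rewrite !natr_fact_neq0 !an0.
Qed.

Variables (F : seq nat) (M s : nat).
Hypotheses (hF : is_pos_set F) (hk : (0 < size F)%N).
Let G := IF F.
Let k := size F.
Let m := size G.
Let d := maxF F.
Let N := (M + d.+1)%N.
(** Keeps (1 + t)^(s - j) a polynomial and the falling factorial of s of length j nonzero for j <=
    m. *)
Hypothesis ms : (m <= s)%N.

Let degs p (r : nat) : nat := nth 0%N (p :: F) r.

Let L p : 'M[K]_k.+1 := \matrix_(r, j) charlier a (degs p r) (s%:R + j%:R).

Let Mm : 'M[K]_m.+1 := \matrix_(r, j)
    (if (r : nat) is l.+1 then charlier (- a) (nth 0%N G l) (- s%:R - 1 + j%:R)
     else falling s%:R j / a ^+ j * charlier a M (s%:R - j%:R)).

Let A0 : {poly K} := \sum_(j < k.+1) cofactor (L N) 0 j *: sg ^+ j.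
Let A := sg ^+ s * A0.

Let wcoefA p : wcoef eta A p = \det (L p).
Proof.
rewrite (expand_det_row _ 0) /A /A0 mulr_sumr wcoef_sum; apply: eq_bigr => j _.
rewrite -scalerAr wcoefZ -exprD wcoef_charlier mxE /degs /= natrD mulrC.
congr (_ * _); rewrite /cofactor; congr (_ * \det _).
by apply/matrixP => r c; rewrite !mxE.
Qed.

Let wcoefA_F f : f \in F -> wcoef eta A f = 0.
Proof.
move=> /(nthP 0%N)[l lk fE]; rewrite wcoefA.
apply: (determinant_alternate (i1 := 0) (i2 := lift 0 (Ordinal lk))) => // j.
by rewrite !mxE /degs /= fE.
Qed.

Definition charlier_minor : K :=
  \det (\matrix_(l < k, j < k) toep (fun n => charlier a n s%:R) (nth 0%N F l) j).

Let cofL : cofactor (L N) 0 ord_max = (-1) ^+ k * charlier_minor.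
Proof.
rewrite /cofactor add0n; congr (_ * _); rewrite /charlier_minor -det_charlier.
congr (\det _); apply/matrixP => l j; rewrite !mxE /degs /=.
by rewrite /bump leqNgt ltn_ord.
Qed.

Let A0_top : (size A0 <= k.+1)%N /\ A0`_k = cofactor (L N) 0 ord_max.
Proof.
split.
  rewrite (leq_trans (size_sum _ _ _)) //; apply/bigmax_leqP => j _.
  by rewrite (leq_trans (size_scale_leq _ _)) // sg_size ltnS leq_ord.
rewrite coef_sum big_ord_recr /= big1 => [|j _]; last first.
  by rewrite coefZ [(sg ^+ _)`__]nth_default ?mulr0 // sg_size.
by have := sg_lead k; rewrite lead_coefE sg_size coefZ add0r => /= ->; rewrite mulr1.
Qed.

(** Column 0 goes with (1 + t)^s, hence with the top coordinate of B; removing it shifts the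
    remaining arguments to - s + j. *)
Let cofM : cofactor Mm 0 0 =
  \det (\matrix_(l < m, j < m) toep (fun n => charlier (- a) n (- s%:R)) (nth 0%N G l) j).
Proof.
rewrite /cofactor expr0 mul1r -det_charlier; congr (\det _).
apply/matrixP => l j; rewrite !mxE /= /bump add1n -natr1; congr charlier; ring.
Qed.

(* Each factor (theta - c) costs one power of 1 + t. *)
Let foldr_top cs : (size cs <= s)%N -> exists Z : {poly K},
  let D := (k + (size cs).*2)%N in
  [/\ foldr (weuler w) A cs = sg ^+ (s - size cs) * Z,
      (size Z <= D.+1)%N & Z`_D = (- a) ^+ size cs * A0`_k].
Proof.
elim: cs => [|c cs IHcs] /=.
  by move=> _; exists A0; have [sA _] := A0_top; rewrite subn0 addn0 mul1r.
move=> css; have [Z [ZE sZ ZD]] := IHcs (ltnW css).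
set u := (s - (size cs).+1)%N; have uE : (s - size cs = u.+1)%N by rewrite /u subnSK.
set D := (k + (size cs).*2)%N in sZ ZD.
(* The product rule applied to (1 + t)^(u + 1) Z, with (1 + t)^u factored out. *)
exists ('X * (u.+1%:R *: Z + sg * wderiv w Z) - c%:R *: (sg * Z)).
have wE n : (wderiv w Z)`_n = Z`_n.+1 *+ n.+1 - a * Z`_n.
  by rewrite /wderiv coefD coef_deriv coefCM mulNr.
have ZE0 n : (D < n)%N -> Z`_n = 0 by move=> Dn; rewrite nth_default // (leq_trans sZ).
have cE n : ('X * (u.+1%:R *: Z + sg * wderiv w Z) - c%:R *: (sg * Z))`_n.+2 =
    u.+1%:R * Z`_n.+1 + (wderiv w Z)`_n.+1 + (wderiv w Z)`_n - c%:R * (Z`_n.+2 + Z`_n.+1).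
  have sgM (p : {poly K}) i : (sg * p)`_i.+1 = p`_i.+1 + p`_i.
    by rewrite /sg mulrDl mul1r coefD coefXM.
  by rewrite coefB coefXM /= coefD !coefZ !sgM addrA.
rewrite doubleS !addnS; split.
- have sgD : sg^`() = 1 by rewrite /sg derivD derivX -polyC1 derivC add0r.
  rewrite ZE uE /weuler /wderiv derivM deriv_exp sgD mul1r /= -!mul_polyC.
  rewrite polyC_natr -[sg ^+ u *+ _]mulr_natl !exprS; ring.
- apply/leq_sizeP => -[|[|n]] // nD; rewrite cE !wE !ZE0; try lia.
  by rewrite !mul0rn !(mulr0, addr0, subr0).
rewrite cE !wE !(ZE0 _.+1) ?(ZE0 _.+2) ?ZD; try lia.
by rewrite !mul0rn exprS; ring.
Qed.

Lemma charlier_identity_minor :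
  \det (L N) * charlier_minor =
  (-1) ^+ (m + k + uF F) *
    ((a ^+ m * M`!%:R * (VF F)%:R * (\prod_(g <- G) g`!%:R) *
      (\prod_(f <- F) (f%:R - N%:R))) /
     (N`!%:R * (VF G)%:R * (\prod_(f <- F) f`!%:R))) *
  \det Mm * charlier_minor.
Proof.
have Gd g : g \in G -> (g <= d)%N by rewrite mem_IF // => /and3P[].
have kmE : (k + m)%N = d.+1 := size_complement hF hk.
have [B [BE wcoefB BW]] := weuler_quotient (exp_seq0 (- a)) (exp_seq_deriv (- a))
  (perm_complement hF hk) Gd wcoefA_F.
have [_ Ak] := A0_top.
have [|Z [ZE sZ ZD]] := @foldr_top [seq (d - g)%N | g <- G]; first by rewrite size_map.
rewrite size_map -/m in ZE sZ ZD.
have kmm : (k + m.*2 = m + d.+1)%N by rewrite -kmE; lia.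
rewrite kmm in sZ ZD.
(* Powers of t and of 1 + t are coprime, so the factor t^(d + 1) divides Z itself. *)
have [B0 ZB] : exists B0, Z = B0 * 'X^(d.+1).
  apply/dvdpP; rewrite -(@Gauss_dvdpr _ _ (sg ^+ (s - m))).
    by rewrite -ZE -BE dvdp_mull.
  by apply: coprimep_expl; apply: coprimep_expr; rewrite sgE coprimep_XsubC rootX eqr_oppLR oppr0 oner_eq0.
have BB0 : B = sg ^+ (s - m) * B0.
  apply: (mulIf (x := 'X^(d.+1))); first by rewrite -size_poly_eq0 size_polyXn.
  by rewrite BE ZE ZB mulrA.
have B0_m : B0`_m = (- a) ^+ m * A0`_k.
  by rewrite -ZD ZB coefMXn ltnNge leq_addl /= addnK.
have sB0 : (size B0 <= m.+1)%N.
  apply/leq_sizeP => i mi; have mi' : (m + d.+1 < i + d.+1)%N by rewrite ltn_add2r.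
  by have /leq_sizeP/(_ _ mi') := sZ; rewrite ZB coefMXn ltnNge leq_addl /= addnK.
have [j|b [B0b bm]] := @basis_decomposition K (fun j => sg ^+ j) m B0 _ sB0.
  exact: sg_size.
rewrite sg_lead mulr1 B0_m Ak cofL in bm.
(* The coordinates are reversed so that column j carries (1 + t)^(s - j), which generates the values
   at s - j in the first row. *)
have Bb : B = \sum_(j < m.+1) b (m - j)%N *: sg ^+ (s - j).
  rewrite BB0 B0b mulr_sumr (reindex_inj rev_ord_inj) /=; apply: eq_bigr => j _.
  rewrite -scalerAr -exprD subSS; congr (_ *: _ ^+ _).
  by have := ltn_ord j; lia.
have fall0 j : (j <= m)%N -> falling s%:R j != 0 :> K.
  by move=> jm; rewrite falling_nat pnatr_eq0 -lt0n ffact_gt0 (leq_trans jm).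
pose bv : 'cV[K]_m.+1 := \col_j (b (m - j)%N * (a ^+ j / falling s%:R j)).
have Nb r : (Mm *m bv) r 0 = (r == 0)%:R * wcoef eta B M.
  rewrite mxE; case: (unliftP 0 r) => [l ->|->]; last first.
    rewrite eqxx mul1r Bb wcoef_sum; apply: eq_bigr => j _.
    have jm : (j <= m)%N := leq_ord j.
    rewrite !mxE /= wcoefZ wcoef_charlier natrB ?(leq_trans jm) //.
    by field; rewrite an0 fall0.
  rewrite mul0r; have [|W [gB WE]] := BW (nth 0%N G l); first by rewrite mem_nth.
  have gG : nth 0%N G l \in G by rewrite mem_nth.
  move: gB WE gG; set g := nth 0%N G l => gB WE gG.
  (* W comes from fewer than m <= s Euler factors, so a positive power of 1 + t survives and the
     boundary term vanishes. *)
  have W1 : W.[-1] = 0.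
    have : (W * 'X^(d - g)).[-1] = 0.
      have cg : (d - g)%N \in [seq (d - g')%N | g' <- G] by apply: map_f.
      have szr : (size (rem (d - g)%N [seq (d - g')%N | g' <- G]) < m)%N.
        by rewrite size_rem // size_map prednK // /m; case: (G) gG.
      have [|Z' [Z'E _ _]] := @foldr_top (rem (d - g)%N [seq (d - g')%N | g' <- G]).
        by apply: leq_trans (ltnW szr) ms.
      rewrite WE Z'E hornerM horner_exp /sg hornerD hornerX hornerC subrr expr0n.
      by rewrite subn_eq0 leqNgt (leq_trans szr ms) mul0r.
    move/eqP; rewrite hornerM hornerXn mulf_eq0 expf_eq0 oppr_eq0 oner_eq0 andbF orbF.
    by move/eqP.
  pose S := (size W + g + s).+1.
  have ellW : ell S ('X^g * B) = 0.
    by rewrite gB ell_wderiv // /S -!addnA leqW // leq_addr.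
  pose c : K := (-1) ^+ g * (g`!%:R * s`!%:R) / a ^+ (g + s).
  have c0 : c != 0 by rewrite !mulf_neq0 ?invr_eq0 ?signr_eq0.
  apply: (mulfI c0); rewrite mulr0; transitivity (ell S ('X^g * B)) => //.
  rewrite Bb mulr_sumr mulr_sumr ell_sum; apply: eq_bigr => j _.
  have jm : (j <= m)%N := leq_ord j.
  have js : (j <= s)%N := leq_trans jm ms.
  rewrite -scalerAr ellZ ell_basis; last by rewrite /S; lia.
  rewrite !mxE /= -/g natrB // opprB.
  have -> : - s%:R - 1 + j%:R = j%:R - s%:R - 1 :> K by ring.
  rewrite /c falling_nat -(ffact_fact js) natrM.
  have -> : a ^+ (g + s) = a ^+ (g + (s - j)) * a ^+ j.
    by rewrite -exprD; congr (_ ^+ _); lia.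
  have sj0 : (s ^_ j)%:R != 0 :> K by rewrite pnatr_eq0 -lt0n ffact_gt0.
  by field; rewrite !an0 sj0.
have := cramer_first_row Nb 0; rewrite [bv _ _]mxE [nat_of_ord 0]/= subn0 bm cofM wcoefB.
rewrite /falling big_ord0 divr1 mulr1 [(- a) ^+ m]exprNn.
set wA := wcoef _ A _; set De := \det (\matrix_(l, j) toep _ _ _) => E.
have wAE : wA = \det (L N) := wcoefA N.
have factE : N`!%:R = _ :> K := fact_complement K M hF hk.
have h0 : charlier a 0 s%:R = 1 by apply: charlier0.
have DE : charlier_minor = _ := det_toep_complement hF hk h0 (charlier_inverse a s).
have gF : ('C(k.+1, 2) <= sumn F)%N.
  by apply: sumn_pos_set; [exact: pos_set_sorted | case/andP: hF].
(* By [weight_complement], sum G - binom(m, 2) = u_F + k. *)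
have sgn : (-1) ^+ (sumn G + 'C(m, 2)) = (-1) ^+ (k + uF F) :> K.
  rewrite -[LHS]signr_odd -[RHS]signr_odd; congr (_ ^+ _).
  have := weight_complement hF hk; move: gF; rewrite /uF -/G -/k -/m binS bin1.
  lia.
have prodE : \prod_(f <- F) (f%:R - N%:R) = (-1) ^+ k * \prod_(f <- F) (N%:R - f%:R) :> K.
  rewrite /k; elim: (F) => [|f s' IHs]; first by rewrite !big_nil mulr1.
  by rewrite !big_cons IHs exprS; ring.
have Pf0 : \prod_(f <- F) f`!%:R != 0 :> K := prod_fact_neq0 _ _.
have VG0 : (VF G)%:R != 0 :> K := VF_neq0 _ (IF_sorted F).
have : N`!%:R != 0 :> K := natr_fact_neq0 N.
rewrite {1}DE prodE -/G sgn -addnA [in RHS]exprD -wAE factE.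
rewrite !mulf_eq0 !negb_or -/G => /andP[/andP[M0 Pg0] PF0].
move: E Pg0 PF0; rewrite -/De.
set Pg' := \prod_(g <- G) (_ + g)%:R; set Pf' := \prod_(f <- F) (_ - _).
move: ((-1) ^+ m) ((-1) ^+ k) (_ ^+ (k + _)) => v kap sn E Pg0 PF0.
transitivity (sn * ((VF F)%:R * \prod_(g <- G) g`!%:R) / ((VF G)%:R * \prod_(f <- F) f`!%:R)
  * (De * (Pg' * wA)) / Pg'); first by field; rewrite Pg0 VG0 Pf0.
rewrite -E; field.
by rewrite VG0 M0 Pg0 PF0 Pf0.
Qed.

End CharlierIdentity.

(** * Removing the common minor *)

Lemma sub_uF F n : (vF F <= n)%N ->
  (n - uF F = (n - vF F) + (maxF F).+1)%N.
Proof. by rewrite /vF; lia. Qed.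

Lemma prod_sub_uF (K : numFieldType) F n : (vF F <= n)%N ->
  \prod_(f <- F) (f%:R - n%:R + (uF F)%:R) =
  \prod_(f <- F) (f%:R - (n - vF F + (maxF F).+1)%:R) :> K.
Proof.
move=> hn; have un : (uF F <= n)%N by apply: leq_trans hn; rewrite /vF -addnA leq_addr.
by apply: eq_bigr => f _; rewrite -(sub_uF hn) (natrB _ un) opprB addrA addrAC.
Qed.

Section Extension.
Variable K : numFieldType.

Lemma horner_det_toep (P : nat -> {poly K}) k (F : seq nat) (x : K) :
  (\det (\matrix_(l < k, j < k) toep P (nth 0%N F l) j)).[x] =
  \det (\matrix_(l < k, j < k) toep (fun n => (P n).[x]) (nth 0%N F l) j).
Proof.
rewrite -[LHS]/(horner_eval x _) -det_map_mx; congr (\det _).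
apply/matrixP => l j; rewrite !mxE /toep /horner_eval; case: ifP => // _.
exact: horner0.
Qed.

Variables (F : seq nat) (n : nat).
Hypotheses (hF : is_pos_set F) (hk : (0 < size F)%N) (hn : (vF F <= n)%N).

(** Both sides are polynomials in x, and the minor is a nonzero polynomial, so
    [charlier_identity_minor] at natural numbers s >= m suffices. *)
Lemma charlier_complement (a x : K) : a != 0 ->
  charlierF a F n x = beta a F n * \det (Mmx a F n x).
Proof.
move=> a0; pose P := charlier_poly a.
have pfun b p c e : polyfun (fun x : K => charlier b p (c * x + e)).
  by apply: polyfun_comp_affine; exists (charlier_poly b p) => y; rewrite horner_charlier_poly.
pose dd y := \det (\matrix_(l < size F, j < size F)
  toep (fun p => charlier a p y) (nth 0%N F l) j).
apply: (@polyfun_eq K (charlierF a F n) (fun x => beta a F n * \det (Mmx a F n x))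
  dd (\det (\matrix_(l < size F, j < size F) toep P (nth 0%N F l) j)) (size (IF F))).
- apply: polyfun_det => r j.
  have [p pE] := pfun a (row_deg F n r) 1 j%:R.
  by exists p => y; rewrite mxE -pE mul1r.
- apply: polyfunM; first exact: polyfun_cst.
  apply: polyfun_det => -[[|r] rP] j.
    have h : polyfun (fun y : K => falling y j / a ^+ j * charlier a (n - vF F) (1 * y + (- j%:R))).
      apply: polyfunM => //; apply: polyfunM; last exact: polyfun_cst.
      by exists (falling_poly K j) => y; rewrite horner_falling_poly.
    by have [p pE] := h; exists p => y; rewrite mxE -pE mul1r.
  have [p pE] := pfun (- a) (nth 0%N (IF F) r) (-1) (-1 + j%:R).
  by exists p => y; rewrite mxE -pE mulN1r addrA.
- move=> y; rewrite horner_det_toep /dd; congr (\det _); apply/matrixP => l j; rewrite !mxE /toep.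
  by case: ifP => //; rewrite horner_charlier_poly.
- apply: (@det_toep_poly_neq0 K P 1) => //.
  + exact: pos_set_sorted.
  + exact: oner_neq0.
  + exact: size_charlier_poly.
  + by move=> p; rewrite coef_charlier_poly expr1n mul1r.
move=> s ms; have := @charlier_identity_minor K a a0 F (n - vF F) s hF hk ms.
rewrite /charlier_minor -/(dd _) => E.
rewrite /charlierF /row_deg (sub_uF hn) [LHS]E /beta (prod_sub_uF K hn) (sub_uF hn).
by [].
Qed.

End Extension.

Lemma hermite_complement (C : numClosedFieldType) (F : seq nat) (n : nat) (x : C) :
    is_pos_set F -> (0 < size F)%N -> (vF F <= n)%N ->
  hermiteF F n x = gamma C F n * \det (Nmx F n x).
Proof.
move=> hF hk hn; pose P p : {poly C} := p`!%:R^-1 *: hermite C p.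
have PE p y : (P p).[y] = hermite_egf y p by rewrite hornerZ mulrC.
apply: (@polyfun_eq C (hermiteF F n) (fun x => gamma C F n * \det (Nmx F n x))
  (fun y => hermite_minor y F)
  (\det (\matrix_(l < size F, j < size F) toep P (nth 0%N F l) j)) 0).
- apply: polyfun_det => r j; exists ((hermite C (row_deg F n r))^`(j)) => y.
  by rewrite mxE.
- apply: polyfunM; first exact: polyfun_cst.
  apply: polyfun_det => -[[|r] rP] j.
    have h : polyfun (fun y : C => (- 'i) ^+ j * (hermite C (n - vF F + j)).[y]).
      by apply: polyfunM; [exact: polyfun_cst | exact: polyfun_horner].
    by have [p pE] := h; exists p => y; rewrite mxE -pE.
  have [p pE] := polyfun_comp_affine (- 'i) 0
    (polyfun_horner ((hermite C (nth 0%N (IF F) r))^`(j))).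
  by exists p => y; rewrite mxE -pE addr0.
- move=> y; rewrite horner_det_toep; congr (\det _); apply/matrixP => l j; rewrite !mxE /toep.
  by case: ifP => //; rewrite PE.
(* The leading coefficient of H_p / p! is 2^p / p!. *)
- apply: (@det_toep_poly_neq0 C P 2%:R).
  + exact: pos_set_sorted.
  + by rewrite pnatr_eq0.
  + by move=> p; rewrite (leq_trans (size_scale_leq _ _)) ?size_hermite.
  + move=> p; rewrite coefZ; have := coef_hermite_even C 0 p; rewrite addn0 => ->.
    by rewrite mulKf ?pnatr_eq0 -?lt0n ?fact_gt0 // fact0 mul1n expr0 mul1r.
move=> s _; have := hermite_identity_minor s%:R (n - vF F) hF hk.
move=> E.
rewrite /hermiteF /row_deg (sub_uF hn) [LHS]E /gamma (prod_sub_uF C hn).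
by rewrite expfzDr ?pnatr_eq0 // -exprnN.
Qed.

Local Open Scope complex_scope.

Theorem mainTheorem11 (R : realType) (a : R) (ha : 0 < a)
    (F : seq nat) (hF : is_pos_set F) (hk : (0 < size F)%N)
    (hadm : admissible F) (n : nat) (hn : (vF F <= n)%N) :
  (forall x : R[i],
     charlierF a%:C F n x = beta a%:C F n * \det (Mmx a%:C F n x)) /\
  (forall x : R[i],
     hermiteF F n x = gamma R[i] F n * \det (Nmx F n x)).
Proof.
split=> x; last exact: hermite_complement.
by apply: charlier_complement; rewrite ?(fmorph_eq0 (real_complex R)) ?gt_eqF.
Qed.
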